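(* Let $T>0$, $A\in\mathbb{R}^{d\times d}$ and $\Sigma\in\mathbb{R}^{d\times m}$. Let $(B_t)_{t\in[0,T)}$ be an $m$-dimensional standard Wiener process and let $(X_t)_{t\in[0,T)}$ be the unique strong solution of $$\mathrm{d}X_t=-\frac{1}{T-t}AX_t\,\mathrm{d}t+\Sigma\,\mathrm{d}B_t,\quad t\in[0,T),\qquad X_0=0\in\mathbb{R}^d.$$ If $\operatorname{ReSpec}(A)\subseteq(0,1/2)$, then $$P\Big(\lim_{t\uparrow T}(T-t)^{-A}X_t=M_T\Big)=1,$$ where $M_T$ is a $d$-dimensional normally distributed random variable. Consequently, for all $\widetilde A\in\mathbb{R}^{d\times d}$ with $A\widetilde A=\widetilde AA$: $$P\Big(\lim_{t\uparrow T}(T-t)^{-\widetilde A}X_t=0\Big)=1\quad\text{if }\operatorname{ReSpec}(A-\widetilde A)\subseteq(0,\infty),$$ $$P\Big(\lim_{t\uparrow T}\big\|(T-t)^{-\widetilde A}X_t\big\|=\infty\Big)=1\quad\text{if }\operatorname{ReSpec}(A-\widetilde A)\subseteq(-\infty,0).$$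
   Context: For $r>0$ and a real square matrix $Q$, $r^Q:=\mathrm{e}^{Q\log r}=\sum_{k=0}^\infty\frac{(\log r)^k}{k!}Q^k$, and $r^{-Q}:=r^{(-Q)}$. $\operatorname{ReSpec}(Q):=\{\operatorname{Re}\lambda:\lambda\in\operatorname{Spec}(Q)\}$, where $\operatorname{Spec}(Q)$ is the set of (complex) eigenvalues of $Q$. $\|\cdot\|$ is the Euclidean norm on $\mathbb{R}^d$. The Wiener process is defined on a filtered probability space $(\Omega,\mathcal{F},(\mathcal{F}_t)_{t\in[0,T)},P)$, where $(\mathcal{F}_t)_{t\in[0,T)}$ is the completion of its canonical filtration. The solution has the representation $X_t=\int_0^t\big(\frac{T-t}{T-s}\big)^A\Sigma\,\mathrm{d}B_s=(T-t)^A\int_0^t(T-s)^{-A}\Sigma\,\mathrm{d}B_s$ for $t\in[0,T)$, and has almost surely continuous sample paths.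
   Formalization: The last claim (norm tends to infinity when ReSpec(A−Ã) ⊆ (−∞,0)) is stated only for Σ ≠ 0, since for Σ = 0 the solution is X = 0 almost surely and the norm stays 0; the other claims hold for every Σ. *)

(* Defs.v *)
From HB Require Import structures.
From mathcomp Require Import all_boot all_order all_algebra.
From mathcomp Require Import all_classical all_reals all_analysis.
From mathcomp Require Import complex.

Set Implicit Arguments.
Unset Strict Implicit.
Unset Printing Implicit Defensive.

Import Order.TTheory GRing.Theory Num.Theory.
Import numFieldNormedType.Exports.

Local Open Scope classical_set_scope.
Local Open Scope ring_scope.

Section MatrixPower.
Context {R : realType} {d : nat}.
Implicit Types (Q : 'M[R]_d) (v : 'cV[R]_d).

Definition mxpowR (r : R) Q : 'M[R]_d :=
  limn (series (fun k : nat => (ln r ^+ k / k`!%:R) *: Q ^+ k)).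

(* [eigenvalue] uses row eigenvectors, which have the same eigenvalues as
   column eigenvectors. *)
Definition Spec Q : set (R[i]) :=
  [set z | eigenvalue (map_mx (real_complex R) Q) z].

Definition ReSpec Q : set R := @complex.Re R @` Spec Q.

(* The library norm on ['cV[R]_d] is the sup norm. *)
Definition enorm v : R := Num.sqrt (\sum_(i < d) v i ord0 ^+ 2).

End MatrixPower.

(* [normal_prob mu 0] is a junk value of the library (the uniform law on
   [0, 1]), whereas N(mu, 0) is the Dirac mass at mu. *)
Definition normal_law {R : realType} (mu s : R) (Y : set R) : \bar R :=
  if s == 0 then \d_mu Y else normal_prob mu s Y.

Section Processes.
Context {dsp : measure_display} {Omega : measurableType dsp} {R : realType}.
Variable P : probability Omega R.

Definition coord_measurable {d : nat} (G : set (set Omega))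
    (Z : Omega -> 'cV[R]_d) : Prop :=
  forall (i : 'I_d) (Y : set R), measurable Y ->
    G ((fun w => Z w i ord0) @^-1` Y).

(* A d-dimensional random vector is normal when all its linear functionals
   are (possibly degenerate) normal random variables. *)
Definition is_normal {d : nat} (Z : Omega -> 'cV[R]_d) : Prop :=
  coord_measurable measurable Z /\
  forall u : 'cV[R]_d, exists mu s : R, 0 <= s /\
    forall Y : set R, measurable Y ->
      P ((fun w => (u^T *m Z w) ord0 ord0) @^-1` Y) = normal_law mu s Y.

Definition canonical_filtration {m : nat} (B : R -> Omega -> 'cV[R]_m)
    (t : R) : set (set Omega) :=
  <<s [set E | exists (s : R) (i : 'I_m) (Y : set R),
         [/\ 0 <= s <= t, measurable Y &
             E = (fun w => B s w i ord0) @^-1` Y]] >>.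

Definition completed_filtration {m : nat} (B : R -> Omega -> 'cV[R]_m)
    (t : R) : set (set Omega) :=
  <<s canonical_filtration B t `|` P.-negligible >>.

Record is_filtration (T : R) (F : R -> set (set Omega)) : Prop := {
  filtration_sigma : forall t : R, 0 <= t < T -> sigma_algebra setT (F t) ;
  filtration_sub : forall t : R, 0 <= t < T -> F t `<=` measurable ;
  filtration_mono : forall s t : R, 0 <= s -> s <= t -> t < T -> F s `<=` F t }.

(* The event that every coordinate i of B_t - B_s lies in Y i.  Such events
   form a generating pi-system of the sigma-algebra of B_t - B_s. *)
Definition increment_event {m : nat} (B : R -> Omega -> 'cV[R]_m) (s t : R)
    (Y : 'I_m -> set R) : set Omega :=
  [set w | forall i, Y i ((B t w - B s w) i ord0)].

(* m-dimensional standard Wiener process on [0, T[; the increment over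
   [s, t] has law N(0, (t - s) I_m), i.e. its coordinates are independent with
   standard deviation sqrt (t - s). *)
Record is_wiener {m : nat} (T : R) (B : R -> Omega -> 'cV[R]_m) : Prop := {
  wiener_measurable : forall t : R, 0 <= t < T ->
    coord_measurable measurable (B t) ;
  wiener_start : {ae P, forall w, B 0 w = 0} ;
  wiener_continuous : {ae P, forall w,
    {within `[0, T[, continuous (fun t => B t w)}} ;
  wiener_increment : forall (s t : R) (Y : 'I_m -> set R),
    0 <= s -> s < t -> t < T -> (forall i, measurable (Y i)) ->
    P (increment_event B s t Y) =
      (\prod_(i < m) normal_prob 0%R (Num.sqrt (t - s)) (Y i))%E ;
  wiener_independent : forall (s t : R) (E : set Omega) (Y : 'I_m -> set R),
    0 <= s -> s < t -> t < T -> canonical_filtration B s E ->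
    (forall i, measurable (Y i)) ->
    P (E `&` increment_event B s t Y) =
      (P E * P (increment_event B s t Y))%E }.

(* Strong solution on [0, T[, with respect to the completed canonical
   filtration of B, of
     dX_t = - (T - t)^-1 A X_t dt + Sigma dB_t,  X_0 = 0.
   The noise coefficient is constant, so the stochastic integral of Sigma over
   [0, t] is Sigma (B_t - B_0) = Sigma B_t.  The drift is continuous on [0, t]
   for t < T, hence integrable there. *)
Record is_strong_solution {d m : nat} (T : R) (A : 'M[R]_d)
    (Sigma : 'M[R]_(d, m)) (B : R -> Omega -> 'cV[R]_m)
    (X : R -> Omega -> 'cV[R]_d) : Prop := {
  solution_adapted : forall t : R, 0 <= t < T ->
    coord_measurable (completed_filtration B t) (X t) ;
  solution_continuous : {ae P, forall w,
    {within `[0, T[, continuous (fun t => X t w)}} ;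
  solution_start : {ae P, forall w, X 0 w = 0} ;
  solution_equation : {ae P, forall w, forall t : R, 0 <= t < T ->
    X t w =
      \col_(i < d) (\int[lebesgue_measure]_(s in `[0, t])
        ((- ((T - s)^-1 *: (A *m X s w))) i ord0))
      + Sigma *m B t w} }.

End Processes.

(* Main.v *)
(* No stochastic integral is needed.  With [f t = (T - t)^-A] and [W = Sigma B],
   the difference [X - W] is differentiable, and integration by parts writes
   [f X] as a term with derivative [f' (W T - W t)] plus [f t (W t - W T)].
   Brownian paths are almost surely Hoelder at [T] with every exponent below
   1/2 (Gaussian tails, Borel-Cantelli on dyadic increments, chaining), while
   [f] blows up more slowly than [(T - t)^-a] for some [a < 1/2]; hence [f X] has
   an almost sure limit [M].  The same integration by parts on small intervals
   makes [f t X t] the pathwise limit of the Riemann sums of the integral of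
   [f] against [W].  These sums are Gaussian by independence of the increments,
   and almost sure limits of centred Gaussian variables are Gaussian, so [M] is
   normal; if [Sigma] is nonzero, some coordinate of [M] has positive variance,
   whence [M] is almost surely nonzero.

   For [A'] commuting with [A],
   [(T - t)^-A' X = (T - t)^(A - A') ((T - t)^-A X)], and the first factor, or
   its inverse, tends to [0] according to the sign of the spectrum of [A - A']. *)

From HB Require Import structures.
Require Import Defs.
From mathcomp Require Import all_boot all_order all_algebra.
From mathcomp Require Import all_classical all_reals all_analysis measurable_realfun.
From mathcomp Require Import complex ring lra.

Set Implicit Arguments.
Unset Strict Implicit.
Unset Printing Implicit Defensive.

Import Order.TTheory GRing.Theory Num.Theory.
Import numFieldNormedType.Exports.

Local Open Scope classical_set_scope.
Local Open Scope ring_scope.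

(** * The matrix exponential *)

(** The weight [f] is unbounded at [T], so neither [f W] nor the integral of [f' W] need converge on
    its own; replacing [W t] by [W t - W T] turns the singularity (T - t)^(-a-1) of [f'] into (T -
    t)^(be-a-1), integrable once [a < be]. Hoelder paths allow only [be < 1/2], hence the need for a
    growth exponent [a] of [f] strictly below 1/2, which the finiteness of the spectrum provides.

    For normality, laws are compared through integrals of continuous functions with values in
    [0, 1]: they determine a law and pass to almost sure limits by dominated convergence.
    Convergence of the standard deviations is read off from one such function, exp(- x^2 / 2), whose
    Gaussian integral is an explicit injective function of the deviation. Limits are taken twice,
    over the mesh at a fixed time and then over times tending to [T]; a lower bound on the
    deviations is carried through both, which is how positive variance reaches the endpoint. *)

Lemma cvg_mxP {K : realType} {m n : nat} {U : Type} {F : set_system U}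
    {FF : Filter F} (f : U -> 'M[K]_(m, n)) (M : 'M[K]_(m, n)) :
  f x @[x --> F] --> M <-> forall i j, f x i j @[x --> F] --> M i j.
Proof.
split=> [fM i j|fM A [P MP PA]].
  exact: (cvg_comp _ _ fM (@coord_continuous _ _ _ i j M)).
have : \forall x \near F, forall i j, P i j (f x i j).
  apply: filter_forall => i; apply: filter_forall => j.
  exact: (fM i j _ (MP i j)).
by apply: filterS => x Px; exact: PA.
Qed.

Lemma cvg_sumr {K : realType} {I U : Type} {F : set_system U} {FF : Filter F}
    (r : seq I) (f : I -> U -> K) (a : I -> K) :
  (forall i, f i x @[x --> F] --> a i) ->
  \sum_(i <- r) f i x @[x --> F] --> \sum_(i <- r) a i.
Proof.
move=> fa; apply: cvg_big => // x.
exact: add_continuous.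
Qed.

Section MatrixExp.
Context {R : realType} {d : nat}.
Implicit Types (Q : 'M[R]_d) (x : R).

(** With [x = ln r] this is [mxpowR r Q]; in the real parameter [x] each entry is an ordinary power
    series and can be differentiated. *)
Definition mxexp Q x : 'M[R]_d :=
  limn (series (fun k : nat => (x ^+ k / k`!%:R) *: Q ^+ k)).

Lemma mxpowRE r Q : mxpowR r Q = mxexp Q (ln r).
Proof. by []. Qed.

(** The sum of all absolute entries dominates every row sum, so it acts as a submultiplicative norm;
    the exponential series is then dominated by a real one. *)
Lemma mxpow_entry_le Q k i j :
  `|(Q ^+ k) i j| <= (\sum_i \sum_j `|Q i j|) ^+ k.
Proof.
elim: k i j => [|k IH] i j.
  by rewrite !expr0 mxE; case: (i == j); rewrite ?mulr1n ?mulr0n ?normr1 ?normr0.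
rewrite !exprS mxE (le_trans (ler_norm_sum _ _ _))//.
set q := \sum_i \sum_j _; have q0 : 0 <= q.
  by apply: sumr_ge0 => ? _; apply: sumr_ge0 => ? _.
apply: (@le_trans _ _ ((\sum_j `|Q i j|) * q ^+ k)).
  rewrite mulr_suml; apply: ler_sum => l _.
  by rewrite normrM ler_wpM2l// IH.
apply: ler_wpM2r; first exact: exprn_ge0.
rewrite /q [leRHS](bigD1 i)//= lerDl.
by apply: sumr_ge0 => ? _; apply: sumr_ge0 => ? _.
Qed.

Definition mxexp_coef Q i j (k : nat) : R := (Q ^+ k) i j / k`!%:R.

Lemma is_cvg_mxexp_pseries Q i j x : cvgn (pseries (mxexp_coef Q i j) x).
Proof.
set q := \sum_i \sum_j `|Q i j|.
apply: normed_cvg.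
apply: (@series_le_cvg _ _ (exp_coeff (q * `|x|))) => [k|k|k|].
- by rewrite /=.
- rewrite /exp_coeff /= divr_ge0// exprn_ge0// mulr_ge0//.
  by apply: sumr_ge0 => ? _; apply: sumr_ge0 => ? _.
- rewrite /exp_coeff /= /mxexp_coef !normrM normrX normfV.
  rewrite exprMn (ger0_norm (_ : 0 <= k`!%:R))// mulrAC.
  by rewrite ler_wpM2r// ?invr_ge0// ler_wpM2r ?exprn_ge0// mxpow_entry_le.
- exact: is_cvg_series_exp_coeff.
Qed.

Lemma mxexp_seriesE Q x n i j :
  series (fun k : nat => (x ^+ k / k`!%:R) *: Q ^+ k) n i j =
  pseries (mxexp_coef Q i j) x n.
Proof.
rewrite /pseries /series /= summxE; apply: eq_bigr => k _.
by rewrite mxE /mxexp_coef; ring.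
Qed.

Lemma mxexpE Q x i j : mxexp Q x i j = limn (pseries (mxexp_coef Q i j) x).
Proof.
suff : series (fun k : nat => (x ^+ k / k`!%:R) *: Q ^+ k) @ \oo -->
       \matrix_(i, j) limn (pseries (mxexp_coef Q i j) x).
  by rewrite /mxexp => /cvg_lim ->//; rewrite mxE.
apply/cvg_mxP => {}i {}j; rewrite mxE.
under eq_fun do rewrite mxexp_seriesE.
exact: is_cvg_mxexp_pseries.
Qed.

Lemma pseries_diffs_mxexp Q i j :
  pseries_diffs (mxexp_coef Q i j) = fun k => (Q ^+ k.+1) i j / k`!%:R.
Proof.
apply/funext => k; rewrite /pseries_diffs /mxexp_coef factS natrM.
by rewrite mulrCA invfM mulVKf.
Qed.

(** Formal counterpart of (e^(xQ))' = Q e^(xQ): the derived series is a finite combination of the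
    original ones and inherits their convergence. *)
Lemma pseries_diffs_mxexp_sum Q i j :
  pseries_diffs (mxexp_coef Q i j) =
  \sum_l (fun k => Q i l * mxexp_coef Q l j k).
Proof.
rewrite pseries_diffs_mxexp; apply/funext => k.
rewrite fct_sumE exprS mxE mulr_suml; apply: eq_bigr => l _.
by rewrite /mxexp_coef mulrA.
Qed.

Lemma cvg_mxexp_pseries_diffs Q i j x :
  pseries (pseries_diffs (mxexp_coef Q i j)) x @ \oo --> (Q *m mxexp Q x) i j.
Proof.
rewrite pseries_diffs_mxexp_sum mxE.
have -> : pseries (\sum_l (fun k => Q i l * mxexp_coef Q l j k)) x =
    (fun n => \sum_l Q i l * pseries (mxexp_coef Q l j) x n).
  apply/funext => n; rewrite /pseries /series /=.
  under [RHS]eq_bigr do rewrite mulr_sumr.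
  rewrite exchange_big /=; apply: eq_bigr => k _.
  rewrite fct_sumE mulr_suml; apply: eq_bigr => l _ /=.
  by rewrite /= mulrA.
apply: cvg_sumr => l; apply: cvgMr.
by rewrite mxexpE; exact: is_cvg_mxexp_pseries.
Qed.

Lemma pseries_diffs2_mxexp_sum Q i j :
  pseries_diffs (pseries_diffs (mxexp_coef Q i j)) =
  \sum_l (fun k => Q i l * pseries_diffs (mxexp_coef Q l j) k).
Proof.
apply/funext => k; rewrite fct_sumE /= {1}/pseries_diffs.
rewrite pseries_diffs_mxexp_sum fct_sumE mulr_sumr; apply: eq_bigr => l _ /=.
by rewrite /pseries_diffs /= mulrCA.
Qed.

Lemma is_cvg_mxexp_pseries_diffs2 Q i j x :
  cvgn (pseries (pseries_diffs (pseries_diffs (mxexp_coef Q i j))) x).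
Proof.
rewrite pseries_diffs2_mxexp_sum.
have -> : pseries (\sum_l (fun k => Q i l * pseries_diffs (mxexp_coef Q l j) k)) x =
    (fun n => \sum_l Q i l * pseries (pseries_diffs (mxexp_coef Q l j)) x n).
  apply/funext => n; rewrite /pseries /series /=.
  under [RHS]eq_bigr do rewrite mulr_sumr.
  rewrite exchange_big /=; apply: eq_bigr => k _.
  rewrite fct_sumE mulr_suml; apply: eq_bigr => l _ /=.
  by rewrite /= mulrA.
apply/cvg_ex; exists (\sum_l Q i l * (Q *m mxexp Q x) l j).
apply: cvg_sumr => l; apply: cvgMr.
exact: cvg_mxexp_pseries_diffs.
Qed.

Lemma is_derive_mxexp Q i j x :
  is_derive x 1 (fun x => mxexp Q x i j) ((Q *m mxexp Q x) i j).
Proof.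
have -> : (fun x => mxexp Q x i j) =
    (fun x => limn (pseries (mxexp_coef Q i j) x)).
  by apply/funext => y; exact: mxexpE.
rewrite -(cvg_lim _ (@cvg_mxexp_pseries_diffs Q i j x))//.
(* Any point of larger absolute value than [x] would do: the series and its first two formal
   derivatives must converge there. *)
apply: (@pseries_snd_diffs _ _ (`|x| + 1)).
- exact: is_cvg_mxexp_pseries.
- by apply: cvgP; exact: cvg_mxexp_pseries_diffs.
- exact: is_cvg_mxexp_pseries_diffs2.
- by rewrite [ltRHS]ger0_norm ?addr_ge0// ltrDl.
Qed.

Lemma mxexp0 Q : mxexp Q 0 = 1%:M.
Proof.
apply/matrixP => i j; rewrite mxexpE; apply: cvg_lim => //.
rewrite -(cvg_shiftn 1%N) /=.
have -> : (fun n => pseries (mxexp_coef Q i j) 0 (n + 1)%N) =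
    cst ((1%:M : 'M[R]_d) i j).
  apply/funext => n; rewrite addn1 /pseries /series /= big_nat_recl//=.
  rewrite big1 ?addr0; last by move=> k _; rewrite expr0n mulr0.
  by rewrite expr0 mulr1 /mxexp_coef expr0 fact0 divr1.
exact: cvg_cst.
Qed.

End MatrixExp.

(** * Entrywise derivatives of matrix functions and the group law of the exponential *)

Section MatrixDerive.
Context {R : realType}.

Definition mx_is_derive {m n : nat} (x : R) (F : R -> 'M[R]_(m, n))
    (dF : 'M[R]_(m, n)) :=
  forall i j, is_derive x 1 (fun x => F x i j) (dF i j).

Lemma mx_is_deriveM {m n p} x (F : R -> 'M[R]_(m, n)) (G : R -> 'M[R]_(n, p))
    dF dG : mx_is_derive x F dF -> mx_is_derive x G dG ->
  mx_is_derive x (fun x => F x *m G x) (dF *m G x + F x *m dG).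
Proof.
move=> hF hG i j.
have -> : (fun x => (F x *m G x) i j) =
    \sum_k ((fun x => F x i k) * (fun x => G x k j)).
  by apply/funext => y; rewrite mxE fct_sumE.
have h k : is_derive x 1 ((fun x => F x i k) * (fun x => G x k j))
   (dF i k * G x k j + F x i k * dG k j).
  have hf := hF i k; have hg := hG k j.
  by apply: is_derive_eq; rewrite /GRing.scale /= addrC mulrC [in X in _ + X]mulrC.
apply: is_derive_eq; rewrite !mxE -big_split /=; exact: eq_bigr.
Qed.

Lemma mx_is_derive_cst {m n} x (C : 'M[R]_(m, n)) : mx_is_derive x (fun=> C) 0.
Proof. by move=> i j; rewrite mxE; exact: is_derive_cst. Qed.

Lemma mx_is_deriveD {m n} x (F G : R -> 'M[R]_(m, n)) dF dG :
  mx_is_derive x F dF -> mx_is_derive x G dG ->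
  mx_is_derive x (fun x => F x + G x) (dF + dG).
Proof.
move=> hF hG i j.
have -> : (fun x => (F x + G x) i j) = (fun x => F x i j) + (fun x => G x i j).
  by apply/funext => y; rewrite mxE.
by have hf := hF i j; have hg := hG i j; rewrite mxE; exact: is_deriveD.
Qed.

Lemma mx_is_derive_eq {m n} x (F : R -> 'M[R]_(m, n)) dF dF' :
  mx_is_derive x F dF -> dF = dF' -> mx_is_derive x F dF'.
Proof. by move=> ? <-. Qed.

Lemma mx_is_derive0_cst {m n} (F : R -> 'M[R]_(m, n)) x y :
  (forall x, mx_is_derive x F 0) -> F x = F y.
Proof.
move=> F0; apply/matrixP => i j; apply: (@is_derive_0_is_cst _ (fun t => F t i j)) => z.
by have := F0 z i j; rewrite mxE.
Qed.

End MatrixDerive.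

Section MatrixExpGroup.
Context {R : realType} {d : nat}.
Implicit Types (P Q : 'M[R]_d) (x : R).

Lemma mx_is_derive_mxexp Q x : mx_is_derive x (mxexp Q) (Q *m mxexp Q x).
Proof. by move=> i j; exact: is_derive_mxexp. Qed.

Lemma comm_mxexp P Q x : P *m Q = Q *m P -> P *m mxexp Q x = mxexp Q x *m P.
Proof.
move=> PQ; apply/matrixP => i j.
have PQk k : P *m Q ^+ k = Q ^+ k *m P.
  by apply: (@commrX 'M[R]_d).
have cE a b : series (fun k : nat => (x ^+ k / k`!%:R) *: Q ^+ k) n a b @[n --> \oo] -->
    mxexp Q x a b.
  under eq_fun do rewrite mxexp_seriesE.
  by rewrite mxexpE; exact: is_cvg_mxexp_pseries.
have PS n : P *m series (fun k : nat => (x ^+ k / k`!%:R) *: Q ^+ k) n =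
     series (fun k : nat => (x ^+ k / k`!%:R) *: Q ^+ k) n *m P.
  rewrite /series /= mulmx_sumr mulmx_suml; apply: eq_bigr => k _.
  by rewrite -scalemxAr -scalemxAl PQk.
set S := series _ in cE PS.
have hl : (P *m S n) i j @[n --> \oo] --> (P *m mxexp Q x) i j.
  under eq_fun do rewrite mxE.
  by rewrite mxE; apply: cvg_sumr => l; apply: cvgMr.
have hr : (P *m S n) i j @[n --> \oo] --> (mxexp Q x *m P) i j.
  under eq_fun do rewrite PS mxE.
  by rewrite mxE; apply: cvg_sumr => l; apply: cvgMl.
exact: (cvg_unique _ hl hr).
Qed.

Lemma mxexpN_mul Q x : mxexp (- Q) x *m mxexp Q x = 1%:M.
Proof.
rewrite (_ : 1%:M = mxexp (- Q) 0 *m mxexp Q 0); last first.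
  by rewrite !mxexp0 mulmx1.
apply: (@mx_is_derive0_cst _ _ _ (fun x => mxexp (- Q) x *m mxexp Q x)) => y.
apply: mx_is_derive_eq.
  by apply: mx_is_deriveM; exact: mx_is_derive_mxexp.
rewrite (@comm_mxexp (- Q))// !mulmxA mulmxN mulNmx.
by rewrite addNr.
Qed.

Lemma mxexp_mulN Q x : mxexp Q x *m mxexp (- Q) x = 1%:M.
Proof. by rewrite -{1}(opprK Q) mxexpN_mul. Qed.

(** The product e^(-(P+Q)y) e^(Py) e^(Qy) has derivative zero, so it keeps its value 1 at [y = 0];
    commutation is what makes the three derivatives cancel. *)
Lemma mxexpD P Q x : P *m Q = Q *m P ->
  mxexp (P + Q) x = mxexp P x *m mxexp Q x.
Proof.
move=> PQ.
pose F y := mxexp (- (P + Q)) y *m (mxexp P y *m mxexp Q y).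
have F1 : F x = 1%:M.
  rewrite (_ : 1%:M = F 0); last by rewrite /F !mxexp0 !mulmx1.
  apply: mx_is_derive0_cst => y; apply: mx_is_derive_eq.
    apply: mx_is_deriveM; first exact: mx_is_derive_mxexp.
    by apply: mx_is_deriveM; exact: mx_is_derive_mxexp.
  rewrite (@comm_mxexp (- (P + Q)) (- (P + Q)))// -mulmxA -mulmxDr.
  rewrite mulNmx mulmxDl !mulmxA -(@comm_mxexp Q P)//.
  by rewrite addNr mulmx0.
by rewrite -[RHS]mul1mx -(mxexp_mulN (P + Q) x) -mulmxA -/(F x) F1 mulmx1.
Qed.

(** Both sides are inverse to [mxexp Q x], the right one by another vanishing derivative. *)
Lemma mxexpN Q x : mxexp (- Q) x = mxexp Q (- x).
Proof.
have h y : mx_is_derive y (fun y => mxexp Q (- y)) (- Q *m mxexp Q (- y)).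
  move=> i j; have := is_derive_mxexp Q i j (- y) => dE.
  have := @is_derive1_comp _ (fun x => mxexp Q x i j) -%R y _ _ dE _.
  move=> /(_ _ (is_deriveNid _ _)); rewrite /comp.
  by move/is_derive_eq; apply; rewrite mulrN1 mulNmx !mxE.
rewrite -[RHS]mul1mx -(mxexpN_mul Q x) -mulmxA.
suff -> : mxexp Q x *m mxexp Q (- x) = 1%:M by rewrite mulmx1.
rewrite (_ : 1%:M = mxexp Q 0 *m mxexp Q (- 0)); last first.
  by rewrite oppr0 !mxexp0 mulmx1.
apply: (@mx_is_derive0_cst _ _ _ (fun x => mxexp Q x *m mxexp Q (- x))) => y.
apply: mx_is_derive_eq.
  by apply: mx_is_deriveM; [exact: mx_is_derive_mxexp|exact: h].
by rewrite (@comm_mxexp Q)// mulNmx mulmxN mulmxA addrN.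
Qed.

End MatrixExpGroup.

(** * Growth of the matrix exponential in terms of the spectrum *)

Section Growth.
Context {R : realType}.

Lemma derive_le0_le (f df : R -> R) (a b : R) : a <= b ->
  (forall x, x \in `]a, b[%R -> is_derive x 1 f (df x)) ->
  (forall x, x \in `]a, b[%R -> df x <= 0) ->
  {within `[a, b], continuous f} -> f b <= f a.
Proof.
rewrite le_eqVlt => /predU1P[<-//|ab] dfE df0 cf.
have [c cab fE] := MVT ab dfE cf.
by rewrite -subr_le0 fE mulr_le0_ge0 ?df0// subr_ge0 ltW.
Qed.

Lemma is_derive_expRM (c x : R) :
  is_derive x 1 (fun x => expR (c * x)) (c * expR (c * x)).
Proof.
have dcx : is_derive x 1 (fun x : R => c * x) c.
  have -> : (fun x : R => c * x) = cst c * id by [].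
  by apply: is_derive_eq; rewrite /GRing.scale /= !mulr1 mulr0 addr0.
rewrite mulrC; exact: (is_derive1_comp (is_derive_expR _) dcx).
Qed.

(** Real form of the complex equation y' = (al + i be) y + z. In the derivative of |y|^2 the
    rotation [be] cancels, and the forcing is absorbed by 2 w z <= dl w^2 + z^2 / dl, where [dl] is
    the gap between [al] and [a]. *)
Lemma derive_growth (u v z1 z2 : R -> R) (al be a C : R) : al < a ->
  (forall x : R, is_derive x 1 u (al * u x - be * v x + z1 x)) ->
  (forall x : R, is_derive x 1 v (al * v x + be * u x + z2 x)) ->
  (forall x : R, 0 <= x -> `|z1 x| <= C * expR (a * x)) ->
  (forall x : R, 0 <= x -> `|z2 x| <= C * expR (a * x)) ->
  exists K, forall x, 0 <= x ->
    `|u x| <= K * expR (a * x) /\ `|v x| <= K * expR (a * x).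
Proof.
move=> ala du dv z1C z2C.
pose dl := a - al; have dl0 : 0 < dl by rewrite subr_gt0.
(* [ga] is the rate of |y|^2 after this absorption. The derivative of |y|^2 exp(- ga x) is then at
   most (2 C^2 / dl) exp(dl x), because 2 a - ga = dl; [K exp(dl x)] is a primitive of this bound,
   so [G] is nonincreasing on the half-line. *)
pose ga := 2 * al + dl; pose K := 2 * C ^+ 2 / dl ^+ 2.
pose G x := (u x ^+ 2 + v x ^+ 2) * expR (- ga * x) - K * expR (dl * x).
pose N0 := u 0 ^+ 2 + v 0 ^+ 2.
have K0 : 0 <= K by apply: divr_ge0; [apply: mulr_ge0 => //|]; exact: sqr_ge0.
have N00 : 0 <= N0 by apply: addr_ge0; exact: sqr_ge0.
pose dG x := (2 * u x * (al * u x - be * v x + z1 x) +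
  2 * v x * (al * v x + be * u x + z2 x)
  - ga * (u x ^+ 2 + v x ^+ 2)) * expR (- ga * x) - K * dl * expR (dl * x).
have dE c x := is_derive_expRM c x.
have dGE (x : R) : is_derive x 1 G (dG x).
  have du' := du x; have dv' := dv x; have d1 := dE (- ga) x; have d2 := dE dl x.
  have h := is_deriveB (is_deriveM (is_deriveD (is_deriveM du' du')
    (is_deriveM dv' dv')) d1) (is_deriveZ K d2).
  have -> : G = (u * u + v * v) * (fun x => expR (- ga * x))
              - K \*: (fun x => expR (dl * x)).
    by apply/funext => y; rewrite /G !expr2.
  apply: (is_derive_eq h).
  by rewrite /dG /GRing.scale /= !fctE /=; ring.
have dG0 x : 0 <= x -> dG x <= 0.
  move=> x0.
  have -> : dG x = (2 * u x * z1 x + 2 * v x * z2 x - dl * (u x ^+ 2 + v x ^+ 2)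
      - 2 * C ^+ 2 / dl * expR (a * x) ^+ 2) * expR (- ga * x).
    rewrite /dG [RHS]mulrBl; congr (_ - _); first by rewrite /ga; ring.
    have -> : expR (dl * x) = expR (a * x) ^+ 2 * expR (- ga * x).
      by rewrite expr2 -!expRD; congr expR; rewrite /ga /dl; ring.
    by rewrite /K; field; rewrite gt_eqF.
  rewrite mulr_le0_ge0 ?expR_ge0//.
  set e := expR _.
  have h (w z : R) : `|z| <= C * e -> 2 * w * z <= dl * w ^+ 2 + C ^+ 2 / dl * e ^+ 2.
    move=> zC.
    have zz : z ^+ 2 <= C ^+ 2 * e ^+ 2.
      by rewrite -exprMn -(real_normK (num_real z)) lerXn2r// nnegrE// (le_trans _ zC).
    apply: (@le_trans _ _ (dl * w ^+ 2 + z ^+ 2 / dl)).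
      rewrite -subr_ge0.
      have -> : dl * w ^+ 2 + z ^+ 2 / dl - 2 * w * z = (dl * w - z) ^+ 2 / dl.
        by field; rewrite gt_eqF.
      by rewrite divr_ge0 ?sqr_ge0// ltW.
    rewrite lerD2l (mulrAC (C ^+ 2)); apply: ler_wpM2r zz; rewrite invr_ge0; exact: ltW.
  have := h (u x) _ (z1C _ x0); have := h (v x) _ (z2C _ x0).
  rewrite (_ : 2 * C ^+ 2 / dl * e ^+ 2 = 2 * (C ^+ 2 / dl * e ^+ 2)); last by ring.
  set q := C ^+ 2 / dl * e ^+ 2; rewrite mulrDr; lra.
(* For [k = K + N0 >= 0], [1 + k] bounds the square root of [k]. *)
exists (1 + (K + N0)) => x x0.
have Gle : G x <= G 0.
  apply: (@derive_le0_le _ dG) => //.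
    by move=> y; rewrite in_itv/= => /andP[y0 _]; apply: dG0; exact: ltW.
  apply: continuous_subspaceT => y.
  by apply: differentiable_continuous; apply/derivable1_diffP; have [] := dGE y.
have NE : u x ^+ 2 + v x ^+ 2 <= (K + N0) * expR (a * x) ^+ 2.
  have e1 : 1 <= expR (dl * x).
    by rewrite -expR0 ler_expR mulr_ge0// ltW.
  have : (u x ^+ 2 + v x ^+ 2) * expR (- ga * x) <= (K + N0) * expR (dl * x).
    move: Gle; rewrite /G !mulr0 expR0 !mulr1 -/N0.
    rewrite lerBlDr => /le_trans; apply.
    have : N0 * 1 <= N0 * expR (dl * x) by rewrite ler_wpM2l.
    by lra.
  rewrite -(ler_pM2r (expR_gt0 (ga * x))) => h.
  have eE : expR (a * x) ^+ 2 = expR (dl * x) * expR (ga * x).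
    by rewrite expr2 -!expRD; congr expR; rewrite /ga /dl; ring.
  have e1' : expR (- ga * x) * expR (ga * x) = 1.
    by rewrite -expRD mulNr addNr expR0.
  by rewrite eE mulrA (le_trans _ h)// -[leRHS]mulrA e1' mulr1.
have fin w : w ^+ 2 <= u x ^+ 2 + v x ^+ 2 -> `|w| <= (1 + (K + N0)) * expR (a * x).
  move=> wN.
  have KN : 0 <= K + N0 := addr_ge0 K0 N00.
  have KN1 : 0 <= 1 + (K + N0) := addr_ge0 ler01 KN.
  rewrite -(@ler_pXn2r _ 2%N)// ?nnegrE ?(mulr_ge0 KN1) ?expR_ge0//.
  rewrite real_normK ?num_real// exprMn (le_trans wN)// (le_trans NE)//.
  rewrite ler_wpM2r ?sqr_ge0//.
  by set q := K + N0 in KN *; nra.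
by split; apply: fin; rewrite ?lerDl ?lerDr sqr_ge0.
Qed.

Section SpectralGrowth.
Context {d : nat}.
Implicit Types (Q U V : 'M[R]_d) (M : 'M[R[i]]_d).

Let cplx Q : 'M[R[i]]_d := map_mx (real_complex R) Q.

Lemma Re_sum (I : Type) (r : seq I) (F : I -> R[i]) :
  complex.Re (\sum_(i <- r) F i) = \sum_(i <- r) complex.Re (F i).
Proof.
elim: r => [|i r IH]; first by rewrite !big_nil.
by rewrite !big_cons -IH; case: (F i) (\sum_(j <- r) F j) => ? ? [].
Qed.

Lemma Im_sum (I : Type) (r : seq I) (F : I -> R[i]) :
  complex.Im (\sum_(i <- r) F i) = \sum_(i <- r) complex.Im (F i).
Proof.
elim: r => [|i r IH]; first by rewrite !big_nil.
by rewrite !big_cons -IH; case: (F i) (\sum_(j <- r) F j) => ? ? [].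
Qed.

(** Real part of M Q = z M + M (Q - z) for complex [M] and real [Q]: splitting only the left factor
    lets the exponential stay a real matrix. *)
Lemma Re_mul_factor M Q (z : R[i]) :
  map_mx (@complex.Re R) M *m Q =
  complex.Re z *: map_mx (@complex.Re R) M - complex.Im z *: map_mx (@complex.Im R) M
  + map_mx (@complex.Re R) (M *m (cplx Q - z%:M)).
Proof.
apply/matrixP => i j; rewrite mulmxBr mul_mx_scalar !mxE.
have -> : complex.Re (\sum_l M i l * cplx Q l j - z * M i j) =
    \sum_l complex.Re (M i l) * Q l j
    - (complex.Re z * complex.Re (M i j) - complex.Im z * complex.Im (M i j)).
  transitivity (complex.Re (\sum_l M i l * cplx Q l j) - complex.Re (z * M i j)).
    by case: (\sum_l _) (z * M i j) => ? ? [].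
  rewrite Re_sum; congr (_ - _); last by case: z (M i j) => ? ? [].
  by apply: eq_bigr => l _; rewrite mxE; case: (M i l) => ? ? /=; rewrite mulr0 subr0.
rewrite addrC subrK; apply: eq_bigr => l _; by rewrite mxE.
Qed.

Lemma Im_mul_factor M Q (z : R[i]) :
  map_mx (@complex.Im R) M *m Q =
  complex.Re z *: map_mx (@complex.Im R) M + complex.Im z *: map_mx (@complex.Re R) M
  + map_mx (@complex.Im R) (M *m (cplx Q - z%:M)).
Proof.
apply/matrixP => i j; rewrite mulmxBr mul_mx_scalar !mxE.
have -> : complex.Im (\sum_l M i l * cplx Q l j - z * M i j) =
    \sum_l complex.Im (M i l) * Q l j
    - (complex.Re z * complex.Im (M i j) + complex.Im z * complex.Re (M i j)).
  transitivity (complex.Im (\sum_l M i l * cplx Q l j) - complex.Im (z * M i j)).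
    by case: (\sum_l _) (z * M i j) => ? ? [].
  rewrite Im_sum; congr (_ - _); last by case: z (M i j) => ? ? [].
  by apply: eq_bigr => l _; rewrite mxE; case: (M i l) => ? ? /=; rewrite mulr0 add0r.
rewrite addrC subrK; apply: eq_bigr => l _; by rewrite mxE.
Qed.

Definition exp_bounded (a : R) Q M := exists C, forall (x : R) i j, 0 <= x ->
  `|(map_mx (@complex.Re R) M *m mxexp Q x) i j| <= C * expR (a * x) /\
  `|(map_mx (@complex.Im R) M *m mxexp Q x) i j| <= C * expR (a * x).

(** The strict gap between the real part of [z] and [a] absorbs the forcing without any polynomial
    factor, so repeated roots need no separate treatment. *)
Lemma exp_bounded_factor (a : R) Q M (z : R[i]) : complex.Re z < a ->
  exp_bounded a Q (M *m (cplx Q - z%:M)) -> exp_bounded a Q M.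
Proof.
move=> za [C HC].
pose U := map_mx (@complex.Re R) M; pose V := map_mx (@complex.Im R) M.
have H i j : exists K, forall x : R, 0 <= x ->
    `|(U *m mxexp Q x) i j| <= K * expR (a * x) /\
    `|(V *m mxexp Q x) i j| <= K * expR (a * x).
  pose U' := map_mx (@complex.Re R) (M *m (cplx Q - z%:M)).
  pose V' := map_mx (@complex.Im R) (M *m (cplx Q - z%:M)).
  have dU (x : R) : is_derive x 1 (fun x => (U *m mxexp Q x) i j)
    (complex.Re z * (U *m mxexp Q x) i j - complex.Im z * (V *m mxexp Q x) i j
     + (U' *m mxexp Q x) i j).
    have := mx_is_deriveM (mx_is_derive_cst x U) (mx_is_derive_mxexp Q x).
    move=> /(_ i j) h; apply: is_derive_eq.
    rewrite mul0mx add0r mulmxA (Re_mul_factor M Q z) !mulmxDl mulNmx.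
    by rewrite -!scalemxAl !mxE.
  have dV (x : R) : is_derive x 1 (fun x => (V *m mxexp Q x) i j)
    (complex.Re z * (V *m mxexp Q x) i j + complex.Im z * (U *m mxexp Q x) i j
     + (V' *m mxexp Q x) i j).
    have := mx_is_deriveM (mx_is_derive_cst x V) (mx_is_derive_mxexp Q x).
    move=> /(_ i j) h; apply: is_derive_eq.
    rewrite mul0mx add0r mulmxA (Im_mul_factor M Q z) !mulmxDl.
    by rewrite -!scalemxAl !mxE.
  apply: (derive_growth za dU dV (C := C)) => x x0.
    by have [h _] := HC x i j x0.
  by have [_ h] := HC x i j x0.
have [K HK] := choice (fun ij => H ij.1 ij.2).
exists (\sum_ij `|K ij|) => x i j x0.
have KS : K (i, j) <= \sum_ij `|K ij|.
  rewrite (bigD1 (i, j))//=; apply: (le_trans (ler_norm _)).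
  by rewrite lerDl sumr_ge0.
have [h1 h2] := HK (i, j) x x0.
by split; [apply: (le_trans h1)|apply: (le_trans h2)];
  rewrite ler_wpM2r ?expR_ge0.
Qed.

Lemma exp_bounded_prod (a : R) Q M (s : seq R[i]) :
  (forall z, z \in s -> complex.Re z < a) ->
  exp_bounded a Q (M *m \big[mulmx/1%:M]_(z <- s) (cplx Q - z%:M)) ->
  exp_bounded a Q M.
Proof.
elim: s M => [|z s IH] M sa; first by rewrite big_nil mulmx1.
rewrite big_cons mulmxA => /IH h.
apply: (@exp_bounded_factor a Q M z); first by apply: sa; rewrite mem_head.
by apply: h => w ws; apply: sa; rewrite inE ws orbT.
Qed.

End SpectralGrowth.

(* Cayley-Hamilton factors [0] as the product of the [Q - z] over the roots [z]
   of the characteristic polynomial.  The factors are removed one at a time: the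
   rows of [M e^(Qx)] solve a linear equation with rate [z] and forcing term
   [M (Q - z) e^(Qx)]. *)
Lemma mxexp_growth {d : nat} (Q : 'M[R]_d.+1) (a : R) :
  ReSpec Q `<=` `]-oo, a[ ->
  exists2 b, b < a & exists2 C, 0 <= C & forall (x : R) i j, 0 <= x ->
    `|mxexp Q x i j| <= C * expR (b * x).
Proof.
move=> Qa.
pose Qc : 'M[R[i]]_d.+1 := map_mx (real_complex R) Q.
have [s sE] := closed_field_poly_normal (char_poly Qc).
rewrite (monicP (char_poly_monic Qc)) scale1r in sE.
have sa z : z \in s -> complex.Re z < a.
  move=> zs; have : ReSpec Q (complex.Re z).
    exists z => //; rewrite /Spec /= eigenvalue_root_char -/Qc sE.
    by rewrite root_prod_XsubC.
  by move/Qa; rewrite /= in_itv.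
(* There are finitely many roots, so the strict bound [a] can be lowered to some [b < a]. *)
have [b ba sb] : exists2 b, b < a & forall z, z \in s -> complex.Re z < b.
  elim: s {sE} sa => [|z s IH] sa.
    by exists (a - 1) => //; rewrite ltrBlDr ltrDl.
  have [|b ba sb] := IH.
    by move=> w ws; apply: sa; rewrite inE ws orbT.
  have za : complex.Re z < a by apply: sa; rewrite mem_head.
  exists (Num.max b ((complex.Re z + a) / 2)); first by rewrite gt_max ba midf_lt.
  move=> w; rewrite inE => /predU1P[->|/sb wb]; rewrite lt_max ?wb//.
  by rewrite midf_lt// orbT.
exists b => //.
have : exp_bounded b Q (1%:M *m \big[mulmx/1%:M]_(z <- s) (Qc - z%:M)).
  rewrite mul1mx (_ : \big[_/_]_(_ <- _) _ = 0).
    have e1 : map_mx (@complex.Re R) (0 : 'M[R[i]]_d.+1) = 0.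
      by apply/matrixP => k l; rewrite mxE [in LHS]mxE [RHS]mxE.
    have e2 : map_mx (@complex.Im R) (0 : 'M[R[i]]_d.+1) = 0.
      by apply/matrixP => k l; rewrite mxE [in LHS]mxE [RHS]mxE.
    by exists 0 => x i j x0; rewrite e1 e2 mul0mx mxE normr0 mul0r.
  transitivity (horner_mx Qc (char_poly Qc)); last exact: Cayley_Hamilton.
  rewrite sE rmorph_prod /=; apply: eq_bigr => z _.
  by rewrite rmorphB /= horner_mx_X horner_mx_C.
move/(exp_bounded_prod sb) => [C HC].
have C0 : 0 <= C.
  have [h _] := HC 0 ord0 ord0 (lexx _); rewrite mulr0 expR0 mulr1 in h.
  exact: le_trans h.
exists C => // x i j x0; have [h _] := HC x i j x0.
suff e : map_mx (@complex.Re R) 1%:M = (1%:M : 'M[R]_d.+1) by rewrite e mul1mx in h.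
by apply/matrixP => k l; rewrite !mxE; case: (k == l).
Qed.

End Growth.

(** * Limits at the endpoint from derivative bounds *)

Section EndpointLimit.
Context {R : realType}.
Implicit Types (h dh : R -> R).

Lemma is_derive_powR_rev (T t a : R) : t < T ->
  is_derive t 1 (fun s => (T - s) `^ a) (- (a * ((T - t) `^ a / (T - t)))).
Proof.
move=> tT.
have T0 : 0 < T - t by rewrite subr_gt0.
have d1 : is_derive t 1 (fun s : R => T - s) (- 1).
  have -> : (fun s : R => T - s) = cst T + -%R by [].
  by apply: is_derive_eq; rewrite add0r.
have := @is_derive1_comp _ (fun x => x `^ a) (fun s => T - s) t _ _ (is_derive1_powR
    a T0) d1.
rewrite powRD; last by apply/implyP => _; rewrite gt_eqF.
by rewrite powRN powRr1 ?ltW// mulrN1.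
Qed.

Lemma cvg_powR_rev (T a : R) : 0 < a -> (T - t) `^ a @[t --> T^'-] --> (0 : R).
Proof.
move=> a0; have /cvgrPdist_lt h := powR_cvg0 a0.
apply/cvgrPdist_lt => e e0.
have [d /= d0 hd] := h _ e0.
exists d => //= t /= Tt tT; apply: hd => /=; last by rewrite subr_gt0.
by rewrite sub0r normrN.
Qed.

(** The function (K / g) (T - t)^g has derivative - K (T - t)^g / (T - t). Subtracting it from [h]
    gives a nondecreasing function, adding it a nonincreasing one; the former is bounded above by
    the latter, hence converges, and the correction tends to 0. *)
Lemma is_cvg_at_left_derive h dh (c T g K : R) : c < T -> 0 < g ->
  (forall t, c < t < T -> is_derive t 1 h (dh t)) ->
  (forall t, c < t < T -> `|dh t| <= K * ((T - t) `^ g / (T - t))) ->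
  cvg (h t @[t --> T^'-]).
Proof.
move=> cT g0 hd hK.
pose p s := (T - s) `^ g.
pose h1 s := h s + K / g * p s.
pose h2 s := h s - K / g * p s.
have d1 t : c < t < T ->
    is_derive t 1 h1 (dh t + K / g * (- (g * ((T - t) `^ g / (T - t))))).
  move=> ct; have ht := hd _ ct; have /andP[_ tT] := ct.
  exact: (is_deriveD ht (is_deriveZ (K / g) (is_derive_powR_rev g tT))).
have d2 t : c < t < T ->
    is_derive t 1 h2 (dh t - K / g * (- (g * ((T - t) `^ g / (T - t))))).
  move=> ct; have ht := hd _ ct; have /andP[_ tT] := ct.
  exact: (is_deriveB ht (is_deriveZ (K / g) (is_derive_powR_rev g tT))).
have KgE y : K / g * (- (g * y)) = - (K * y) by field; rewrite gt_eqF.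
have ddc (u du : R -> R) : (forall t, c < t < T -> is_derive t 1 u (du t)) ->
    forall s t, c < s -> t < T -> {within `[s, t], continuous u}.
  move=> ud s t cs tT; apply: derivable_within_continuous => x.
  rewrite in_itv/= => /andP[sx xt].
  by have [] : is_derive x 1 u (du x) by apply: ud; rewrite (lt_le_trans cs)//=
      (le_lt_trans xt).
have mono1 s t : c < s -> s <= t -> t < T -> h1 t <= h1 s.
  move=> cs st tT; apply: (derive_le0_le st _ _ (ddc _ _ d1 _ _ cs tT)) => x.
    by rewrite in_itv/= => /andP[sx xt]; apply: d1; rewrite (lt_trans cs)//=
        (lt_trans xt).
  rewrite in_itv/= => /andP[sx xt]; rewrite KgE subr_le0.
  apply: (le_trans (ler_norm _)); apply: hK.
  by rewrite (lt_trans cs)//= (lt_trans xt).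
have mono2 s t : c < s -> s <= t -> t < T -> h2 s <= h2 t.
  move=> cs st tT; rewrite -lerN2.
  apply: (@derive_le0_le _ (fun x => - h2 x) (fun x => - (dh x - K / g * (- (g * ((T
      - x) `^ g / (T - x)))))) _ _ st).
  - move=> x; rewrite in_itv/= => /andP[sx xt]; apply: is_deriveN; apply: d2.
    by rewrite (lt_trans cs)//= (lt_trans xt).
  - move=> x; rewrite in_itv/= => /andP[sx xt]; rewrite KgE opprK oppr_le0.
    rewrite -lerBlDr sub0r; have : `|dh x| <= K * ((T - x) `^ g / (T - x)).
      by apply: hK; rewrite (lt_trans cs)//= (lt_trans xt).
    by rewrite ler_norml => /andP[].
  - by move=> x; apply: continuousN; exact: (ddc _ _ d2).
have p0 s : 0 <= p s by exact: powR_ge0.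
have K0 : 0 <= K / g.
  have [t ct] : exists t, c < t < T by exists ((c + T) / 2); rewrite midf_lt//= midf_lt.
  have := le_trans (normr_ge0 _) (hK _ ct).
  have /andP[_ tT] := ct.
  rewrite pmulr_lge0; last by rewrite divr_gt0 ?powR_gt0 ?subr_gt0.
  by move=> ?; rewrite divr_ge0// ltW.
have ch2 : cvg (h2 t @[t --> T^'-]).
  pose m := (c + T) / 2.
  have cm : c < m by rewrite midf_lt.
  have mT : m < T by rewrite midf_lt.
  apply: nondecreasing_at_left_is_cvgr; near=> x.
    move=> s t; rewrite !in_itv/= => /andP[xs sT] /andP[xt tT] st.
    apply: mono2 => //; apply: lt_trans xs; near: x; exact: nbhs_left_gt.
  exists (h1 m) => _ [t /= + <-]; rewrite in_itv/= => /andP[xt tT].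
  have mt : m <= t.
    apply: (le_trans _ (ltW xt)); near: x; exact: nbhs_left_ge.
  apply: le_trans (mono1 _ _ cm mt tT).
  by rewrite /h1 /h2 lerD2l (@le_trans _ _ 0)// ?oppr_le0 mulr_ge0.
have -> : h = h2 \+ (fun s => K / g * p s) by apply/funext => s; rewrite /h2 /= subrK.
apply: is_cvgD => //; apply: is_cvgMr; apply: cvgP; exact: cvg_powR_rev g0.
Unshelve. all: by end_near. Qed.

End EndpointLimit.

Section PowerAtEndpoint.
Context {R : realType}.

Lemma mx_is_derive_mxpow {d : nat} (A : 'M[R]_d) (T t : R) : t < T ->
  mx_is_derive t (fun s => mxpowR (T - s) (- A))
    ((T - t)^-1 *: (A *m mxpowR (T - t) (- A))).
Proof.
move=> tT i j.
have T0 : 0 < T - t by rewrite subr_gt0.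
have d1 : is_derive t 1 (fun s : R => T - s) (- 1).
  have -> : (fun s : R => T - s) = cst T + -%R by [].
  by apply: is_derive_eq; rewrite add0r.
have d2 := @is_derive1_comp _ (@ln R) (fun s => T - s) t _ _ (is_derive1_ln T0) d1.
have d3 := @is_derive1_comp _ (fun x => mxexp (- A) x i j)
  (fun s => ln (T - s)) t _ _ (is_derive_mxexp (- A) i j (ln (T - t))) d2.
apply: (is_derive_eq d3).
by rewrite mulNmx !mxE mulrN1 mulrNN mulrC.
Qed.

(** For [0 < r <= 1] the number [- ln r] is nonnegative and r^(-Q) = e^(Q (- ln r)), so the
    exponential bound becomes a power of [r]. *)
Lemma mxpow_growth {d : nat} (Q : 'M[R]_d.+1) (a : R) :
  ReSpec Q `<=` `]-oo, a[ ->
  exists2 b, b < a & exists2 C, 0 <= C & forall (r : R) i j, 0 < r <= 1 ->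
    `|mxpowR r (- Q) i j| <= C * r `^ (- b).
Proof.
move=> /mxexp_growth[b ba [C C0 HC]]; exists b => //; exists C => // r i j /andP[r0 r1].
rewrite mxpowRE mxexpN (le_trans (HC _ _ _ _))//.
  by rewrite oppr_ge0 ln_le0.
by rewrite /powR gt_eqF// mulrN mulNr.
Qed.

Lemma ReSpecN {d : nat} (Q : 'M[R]_d) x : ReSpec (- Q) x -> ReSpec Q (- x).
Proof.
move=> [z /eigenvalueP [v vE v0] <-].
exists (- z); last by case: z {vE}.
apply/eigenvalueP; exists v => //.
rewrite scaleNr -vE -mulmxN; congr (_ *m _).
by apply/matrixP => i j; rewrite !mxE rmorphN opprK.
Qed.

(** The growth bound for [- Q] has a strictly negative exponent [b], so that (T - t)^(-b) tends to
    0. *)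
Lemma cvg_mxpow_0 {d : nat} (Q : 'M[R]_d.+1) (T : R) :
  ReSpec Q `<=` `]0, +oo[ ->
  mxpowR (T - t) Q @[t --> T^'-] --> (0 : 'M[R]_d.+1).
Proof.
move=> Q0.
have : ReSpec (- Q) `<=` `]-oo, 0[.
  move=> x /ReSpecN /Q0 /=; rewrite !in_itv/= andbT; by rewrite oppr_gt0.
move=> /mxpow_growth[b b0 [C C0 HC]]; apply/cvg_mxP => i j; rewrite mxE.
apply/norm_cvg0P.
have cC : C * (T - t) `^ (- b) @[t --> T^'-] --> (0 : R).
  rewrite -(mulr0 C); apply: cvgMr; apply: cvg_powR_rev; by rewrite oppr_gt0.
apply: (squeeze_cvgr _ (cvg_cst 0) cC).
near=> t; rewrite normr_ge0 /= -{1}(opprK Q) HC// subr_gt0; apply/andP; split.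
  by near: t; exact: nbhs_left_lt.
rewrite lerBlDr -lerBlDl; near: t; apply: nbhs_left_ge; by rewrite ltrBlDr ltrDl.
Unshelve. all: by end_near. Qed.

(* The integration by parts [f X = f (Z + w) + f (W - w)], where
   [f t = (T - t)^-A], [Z = X - W] and [w = W T]: the derivative of the first
   term involves only the increment [W T - W t]. *)
Lemma solution_endpoint_cvg {d : nat} (A : 'M[R]_d.+1) (T a be eta C1 C : R)
    (X W : R -> 'cV[R]_d.+1) (w : 'cV[R]_d.+1) :
  (forall r i j, 0 < r <= 1 -> `|mxpowR r (- A) i j| <= C1 * r `^ (- a)) ->
  a < be -> 0 < eta ->
  (forall t, T - eta < t < T ->
    mx_is_derive t (fun s => X s - W s) (- (T - t)^-1 *: (A *m X t))) ->
  (forall t i, T - eta < t < T -> `|(W t - w) i ord0| <= C * (T - t) `^ be) ->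
  cvg (mxpowR (T - t) (- A) *m X t @[t --> T^'-]).
Proof.
move=> fC abe eta0 dZ hW.
pose f t := mxpowR (T - t) (- A).
pose H t := f t *m (X t - W t + w).
(* Beyond [T - 1] one has [T - t <= 1], the range of the power bound on [f]. *)
pose c := Num.max (T - eta) (T - 1).
have cT : c < T by rewrite gt_max !ltrBlDr !ltrDl eta0 ltr01.
have cP t : c < t < T -> [/\ T - eta < t < T, 0 < T - t <= 1 & t < T].
  rewrite gt_max => /andP[/andP[t1 t2] tT]; split; rewrite ?t1 ?tT//.
  by rewrite subr_gt0 tT/= lerBlDr -lerBlDl ltW.
have dH t : c < t < T ->
    mx_is_derive t H ((T - t)^-1 *: (f t *m A *m (w - W t))).
  move=> /cP[t1 t2 tT].
  have dZw : mx_is_derive t (fun s => X s - W s + w) (- (T - t)^-1 *: (A *m X t)).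
    by rewrite -[- _ *: _]addr0; apply: mx_is_deriveD; [exact: dZ|exact:
        mx_is_derive_cst].
  apply: (mx_is_derive_eq (mx_is_deriveM (mx_is_derive_mxpow A tT) dZw)).
  have cA : A *m f t = f t *m A by apply: comm_mxexp; rewrite mulmxN mulNmx.
  rewrite -/(f t) cA.
  rewrite -scalemxAl -scalemxAr scaleNr -scalerN -scalerDr mulmxA.
  rewrite -mulmxBr; congr (_ *: (_ *m _)).
  by apply/matrixP => i j; rewrite !mxE; ring.
have ft i j t : c < t < T -> `|f t i j| <= C1 * (T - t) `^ (- a).
  by move=> /cP[_ t2 _]; exact: fC.
pose S (i : 'I_d.+1) := \sum_(k < d.+1) \sum_(l < d.+1) `|A l k|.
have HK i t : c < t < T -> `|((T - t)^-1 *: (f t *m A *m (w - W t))) i ord0| <=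
    (C1 * S i * C) * ((T - t) `^ (be - a) / (T - t)).
  move=> ct; have [t1 /andP[T0 _] tT] := cP _ ct.
  rewrite mxE normrM gtr0_norm ?invr_gt0//.
  rewrite mulrA [leRHS]mulrC; apply: ler_wpM2l; first by rewrite invr_ge0 ltW.
  rewrite mxE (le_trans (ler_norm_sum _ _ _))//.
  rewrite /S mulr_sumr mulr_suml mulr_suml; apply: ler_sum => k _.
  rewrite normrM powRD; last by apply/implyP => _; rewrite gt_eqF.
  rewrite (_ : _ * _ * (_ * _) = (C1 * (T - t) `^ (- a) * (\sum_l `|A l k|)) *
     (C * (T - t) `^ be)); last by ring.
  apply: ler_pM => //; last by rewrite -opprB mxE normrN; exact: hW.
  rewrite mxE (le_trans (ler_norm_sum _ _ _))// mulr_sumr.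
  by apply: ler_sum => l _; rewrite normrM ler_wpM2r// ft.
have cH i : cvg (H t i ord0 @[t --> T^'-]).
  apply: (@is_cvg_at_left_derive _ (fun t => H t i ord0) _ c T (be - a) _ cT) (HK i).
    by rewrite subr_gt0.
  by move=> t ct; exact: dH.
have cfw : f t *m (W t - w) @[t --> T^'-] --> (0 : 'cV[R]_d.+1).
  apply/cvg_mxP => i j; rewrite ord1 mxE; apply/norm_cvg0P.
  have : \sum_(k < d.+1) C1 * C * (T - t) `^ (be - a) @[t --> T^'-] -->
     \sum_(k < d.+1) (C1 * C * 0).
    by apply: cvg_sumr => k; apply: cvgMr; apply: cvg_powR_rev; rewrite subr_gt0.
  rewrite (_ : \sum_(_ < _) _ = 0); last by rewrite big1// => k _; rewrite mulr0.
  apply: squeeze_cvgr (cvg_cst 0).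
  near=> t; have ct : c < t < T by apply/andP; split; near: t; [exact:
      nbhs_left_gt|exact: nbhs_left_lt].
  have [t1 /andP[T0 _] tT] := cP _ ct.
  rewrite normr_ge0 /= mxE (le_trans (ler_norm_sum _ _ _))//; apply: ler_sum => k _.
  rewrite normrM powRD; last by apply/implyP => _; rewrite gt_eqF.
  rewrite [leRHS](_ : _ = (C1 * (T - t) `^ (- a)) * (C * (T - t) `^ be)); last by ring.
  by apply: ler_pM => //; [exact: ft|exact: hW].
pose M := \col_i lim (H t i ord0 @[t --> T^'-]).
apply/cvg_ex; exists (M + 0).
have -> : (fun t => mxpowR (T - t) (- A) *m X t) = (fun t => H t + f t *m (W t - w)).
  by apply/funext => t; rewrite /H -mulmxDr addrACA subrr addr0 subrK.
apply: cvgD => //.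
by apply/cvg_mxP => i j; rewrite ord1 mxE; exact: cH.
Unshelve. all: by end_near. Qed.

End PowerAtEndpoint.

(** * Riemann sums along a solution path *)

Section RiemannSums.
Context {R : realType}.
Implicit Types (a b t : R).

Lemma within_continuous_dist (g : R -> R) (D : set R) (x : R) :
  {within D, continuous g} -> D x ->
  forall e, 0 < e -> exists2 dl, 0 < dl &
    forall y, D y -> `|x - y| < dl -> `|g x - g y| < e.
Proof.
move=> gD Dx e e0.
have /subspace_continuousP/(_ x Dx)/cvgrPdist_lt/(_ e e0) := gD.
by move=> [dl /= dl0 hd]; exists dl => // y Dy xy; apply: hd.
Qed.

(** Compactness enters in near-covering form, with the modulus as the parameter that tends to 0 from
    the right. *)
Lemma uniform_continuity_itv (g : R -> R) a b : {within `[a, b], continuous g} ->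
  forall e, 0 < e -> exists2 dl, 0 < dl & forall x y, a <= x <= b -> a <= y <= b ->
    `|x - y| < dl -> `|g x - g y| < e.
Proof.
move=> gc e e0.
have /compact_near_coveringP/(_ R 0^'+
   (fun dl x => `[a, b]%classic x -> forall y, `[a, b]%classic y -> `|x - y| < dl ->
       `|g x - g y| < e)) :=
  @segment_compact _ a b.
case.
  move=> x abx.
  have [|d d0 hd] := within_continuous_dist gc abx (e := e / 2); first by rewrite
      divr_gt0.
  exists (ball x (d / 2), [set r | 0 < r < d / 2]).
    split => /=; first by apply: nbhsx_ballx; rewrite divr_gt0.
    exists (d / 2); first by rewrite /= divr_gt0.
    by move=> r /=; rewrite sub0r normrN => h1 r0; rewrite r0 /= (le_lt_trans
        (ler_norm _)).
  move=> [x' r] [/= xx' /andP[r0 rd]] abx' y aby x'y.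
  have h1 : `|g x - g x'| < e / 2.
    apply: hd => //; apply: (lt_trans xx'); by rewrite ltr_pdivrMr// ltr_pMr// ltr1n.
  have h2 : `|g x - g y| < e / 2.
    apply: hd => //; rewrite (_ : x - y = (x - x') + (x' - y)); last by ring.
    rewrite (le_lt_trans (ler_normD _ _))// (splitr d) ltrD//.
    exact: lt_trans x'y rd.
  rewrite (_ : g x' - g y = (g x - g y) - (g x - g x')); last by ring.
  by rewrite (le_lt_trans (ler_normB _ _))// (splitr e) ltrD.
move=> d /= d0 hd; exists (d / 2); first by rewrite divr_gt0.
move=> x y abx aby xy; apply: (hd (d / 2)) => //=.
- by rewrite sub0r normrN gtr0_norm ?divr_gt0// ltr_pdivrMr// ltr_pMr// ltr1n.
- by rewrite divr_gt0.
Qed.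

Lemma within_continuous_bounded (g : R -> R) a b : a <= b ->
  {within `[a, b], continuous g} ->
  exists K, forall x, a <= x <= b -> `|g x| <= K.
Proof.
move=> ab gc.
have [c1 _ h1] := EVT_max ab gc; have [c2 _ h2] := EVT_min ab gc.
exists (`|g c1| + `|g c2|) => x abx.
have m1 := h1 x; have m2 := h2 x.
rewrite !in_itv/= in m1 m2; have {}m1 := m1 abx; have {}m2 := m2 abx.
rewrite ler_norml; apply/andP; split.
  rewrite lerNl; apply: (@le_trans _ _ (- g c2)); first by rewrite lerN2.
  by apply: le_trans (ler_norm _) _; rewrite normrN lerDr.
by rewrite (le_trans m1)// (le_trans (ler_norm _))// lerDl.
Qed.

Lemma mean_value_le (q dq : R -> R) a b K : a <= b ->
  (forall x, x \in `]a, b[%R -> is_derive x 1 q (dq x)) ->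
  {within `[a, b], continuous q} ->
  (forall x, a <= x <= b -> `|dq x| <= K) ->
  `|q b - q a| <= K * (b - a).
Proof.
move=> ab dqE qc qK.
have [c cab ->] := MVT_segment ab dqE qc.
rewrite normrM [X in _ * X]ger0_norm ?subr_ge0//.
by rewrite ler_wpM2r ?subr_ge0// qK//; move: cab; rewrite in_itv.
Qed.

Lemma sum_ord_const (n : nat) (c : R) :
  \sum_(j < n) c = c * n%:R.
Proof. by rewrite sumr_const card_ord mulr_natr. Qed.

(* On [[u, v]] the increment of [f X] minus [f u (W v - W u)] is the increment
   of [s |-> f s (X s - W s) + f s (W v)], whose derivative is [f' s (W v - W s)]. *)
Lemma solution_riemann {d : nat} (A : 'M[R]_d) (T t : R) (X W : R -> 'cV[R]_d) :
  0 <= t < T ->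
  (forall i, {within `[0, T[, continuous (fun s => X s i ord0)}) ->
  (forall i, {within `[0, T[, continuous (fun s => W s i ord0)}) ->
  (forall s, 0 < s < T ->
    mx_is_derive s (fun s => X s - W s) (- (T - s)^-1 *: (A *m X s))) ->
  X 0 = 0 ->
  \sum_(j < n.+1) mxpowR (T - t * (j%:R / n.+1%:R)) (- A) *m
     (W (t * (j.+1%:R / n.+1%:R)) - W (t * (j%:R / n.+1%:R))) @[n --> \oo] -->
  mxpowR (T - t) (- A) *m X t.
Proof.
move=> /andP[t0 tT] cX cW dZ X0.
pose f s := mxpowR (T - s) (- A).
pose f' s := (T - s)^-1 *: (A *m f s).
pose g (n j : nat) : R := t * (j%:R / n.+1%:R).
have gle n j : (j <= n.+1)%N -> 0 <= g n j <= t.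
  move=> jn; rewrite /g mulr_ge0 ?divr_ge0//= ler_piMr// ler_pdivrMr ?ltr0n//.
  by rewrite mul1r ler_nat.
have gS n j : g n j.+1 - g n j = t / n.+1%:R.
  by rewrite /g -mulrBr -mulrBl -natrB// subSnn mul1r.
have df i j s : s < T -> is_derive s 1 (fun s => f s i j) (f' s i j).
  by move=> sT; exact: (mx_is_derive_mxpow A sT i j).
have sub : `[0, t] `<=` `[0, T[.
  by move=> s /=; rewrite !in_itv/= => /andP[-> /= st]; exact: le_lt_trans tT.
have cXt i : {within `[0, t], continuous (fun s => X s i ord0)}.
  by apply: continuous_subspaceW (cX i).
have cWt i : {within `[0, t], continuous (fun s => W s i ord0)}.
  by apply: continuous_subspaceW (cW i).
have cf i j : {within `[0, t], continuous (fun s => f s i j)}.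
  apply: derivable_within_continuous => s; rewrite in_itv/= => /andP[_ st].
  by have [] := df i j s (le_lt_trans st tT).
have [F HF] : exists F, forall i j s, 0 <= s <= t -> `|f s i j| <= F.
  have [F HF] := choice (fun ij => within_continuous_bounded t0 (cf ij.1 ij.2)).
  exists (\sum_ij `|F ij|) => i j s s0t; apply: le_trans (HF (i, j) s s0t) _.
  by rewrite (bigD1 (i, j))//= (le_trans (ler_norm _))// lerDl sumr_ge0.
pose G := (T - t)^-1 * \sum_i \sum_j `|A i j| * F.
have HG i j s : 0 <= s <= t -> `|f' s i j| <= G.
  move=> /andP[s0 st]; have Ts : 0 < T - s by rewrite subr_gt0 (le_lt_trans st).
  have F0 : 0 <= F by apply: le_trans (HF i j s _); rewrite ?s0.
  rewrite mxE normrM gtr0_norm ?invr_gt0//; apply: ler_pM => //.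
  - by rewrite invr_ge0 ltW.
  - by rewrite lef_pV2 ?posrE ?Ts ?subr_gt0// lerD2l lerN2.
  rewrite mxE (le_trans (ler_norm_sum _ _ _))// [leRHS](bigD1 i)//= -[leLHS]addr0 lerD//.
    by apply: ler_sum => k _; rewrite normrM ler_wpM2l// HF// s0.
  by apply: sumr_ge0 => k _; apply: sumr_ge0 => l _; rewrite mulr_ge0.
have G0 : (0 < d)%N -> 0 <= G.
  move=> d0; apply: le_trans (HG (Ordinal d0) (Ordinal d0) 0 _) => //.
  by rewrite lexx.
apply/cvg_mxP => i j; rewrite ord1 {j}.
have {}G0 : 0 <= G by apply: G0; apply: leq_trans (ltn_ord i).
pose q (v : R) s := (f s *m (X s - W s + W v)) i ord0.
have qE u v : (f v *m X v - f u *m X u - f u *m (W v - W u)) i ord0 = q v v - q v u.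
  rewrite /q subrK.
  have -> : f u *m (X u - W u + W v) = f u *m X u + f u *m (W v - W u).
    by rewrite -mulmxDr addrAC addrA.
  by rewrite !mxE opprD addrA.
have cq v : {within `[0, t], continuous (q v)}.
  rewrite (_ : q v = fun s => \sum_k f s i k * (X s k ord0 - W s k ord0 + W v k
      ord0)); last first.
    by apply/funext => s; rewrite /q mxE; apply: eq_bigr => k _; rewrite !mxE.
  move=> x; apply: cvg_sumr => k; apply: cvgM; first exact: cf.
  by apply: cvgD; [apply: cvgB; [exact: cXt|exact: cWt]|exact: cvg_cst].
have dq v s : 0 < s < T -> is_derive s 1 (q v) ((f' s *m (W v - W s)) i ord0).
  move=> /[dup] /dZ dZs /andP[s0 sT].
  have dZw : mx_is_derive s (fun s => X s - W s + W v) (- (T - s)^-1 *: (A *m X s)).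
    by rewrite -[- _ *: _]addr0; apply: mx_is_deriveD => //; exact: mx_is_derive_cst.
  apply: (mx_is_derive_eq (mx_is_deriveM (mx_is_derive_mxpow A sT) dZw)).
  have cA : A *m f s = f s *m A by apply: comm_mxexp; rewrite mulmxN mulNmx.
  rewrite /f' -/(f s) cA -!scalemxAl -scalemxAr scaleNr -scalerN -scalerDr mulmxA.
  rewrite -mulmxBr; congr (_ *: (_ *m _)).
  by apply/matrixP => k l; rewrite !mxE; ring.
apply/cvgrPdist_lt => e e0.
(* Each cell errs by at most [d G om] times its length, in all [d G om t < e]; the [+ 1] keeps the
   denominator positive. *)
pose om := e / (d%:R * G * t + 1).
have dGt : 0 <= d%:R * G * t.
  by apply: mulr_ge0 => //; exact: (mulr_ge0 _ G0).
have om0 : 0 < om by rewrite divr_gt0// ltr_wpDl.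
have [dl dl0 Hdl] : exists2 dl, 0 < dl & forall k u v, 0 <= u <= t -> 0 <= v <= t ->
    `|u - v| < dl -> `|W u k ord0 - W v k ord0| < om.
  have /(_ _)/cid2 H k := uniform_continuity_itv (cWt k) om0.
  exists (\big[Num.min/1]_k sval (H k)).
    by apply: lt_bigmin => // k _; case: (H k).
  move=> k u v u0 v0 uv; case: (H k) (bigmin_le_cond 1 (fun k => sval (H k)) (isT :
      xpredT k)) => /= dk dk0 Hk ldk.
  apply: Hk => //; exact: lt_le_trans uv ldk.
have hN : \forall n \near \oo, t / n.+1%:R < dl.
  have /cvgrPdist_lt/(_ dl dl0) : t * @harmonic R n @[n --> \oo] --> t * 0.
    by apply: cvgMr; exact: cvg_harmonic.
  apply: filterS => n; rewrite mulr0 sub0r normrN; apply: le_lt_trans.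
  exact: ler_norm.
near=> n.
have hn : t / n.+1%:R < dl.
  by near: n.
have -> : (f t *m X t) i ord0 = \sum_(j < n.+1) (f (g n j.+1) *m X (g n j.+1) - f (g
    n j) *m X (g n j)) i ord0.
  rewrite -(big_mkord xpredT (fun j => (f (g n j.+1) *m X (g n j.+1) - f (g n j) *m X
      (g n j)) i ord0)).
  rewrite -summxE telescope_sumr// /g mul0r mulr0 X0 mulmx0 subr0.
  by rewrite divff// mulr1.
rewrite summxE -sumrB.
rewrite (eq_bigr (fun j : 'I_n.+1 => q (g n j.+1) (g n j.+1) - q (g n j.+1) (g n
    j))); last first.
  by move=> j _; rewrite -qE [RHS]mxE; congr (_ + _); rewrite [RHS]mxE.
rewrite (le_lt_trans (ler_norm_sum _ _ _))//.
apply: (@le_lt_trans _ _ (\sum_(j < n.+1) (d%:R * G * om) * (t / n.+1%:R))).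
  apply: ler_sum => j _.
  have /andP[g0 gt'] := gle n j (ltnW (ltn_ord j)).
  have /andP[g1 gt1] := gle n j.+1 (ltn_ord j).
  have gg : g n j <= g n j.+1 by rewrite -subr_ge0 gS divr_ge0.
  rewrite -(gS n j); apply: (mean_value_le gg).
  - by move=> x; rewrite in_itv/= => /andP[x1 x2]; apply: dq;
      rewrite (le_lt_trans g0)//= (lt_le_trans x2)// (le_trans gt1)// ltW.
  - apply: continuous_subspaceW (cq _) => x /=; rewrite !in_itv/= => /andP[x1 x2].
    by rewrite (le_trans g0)//= (le_trans x2).
  - move=> x /andP[x1 x2]; rewrite mxE (le_trans (ler_norm_sum _ _ _))//.
    have x0t : 0 <= x <= t by rewrite (le_trans g0)//= (le_trans x2).
    rewrite (_ : d%:R * G * om = G * om * d%:R); last by ring.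
    rewrite -sum_ord_const.
    apply: ler_sum => k _; rewrite normrM; apply: ler_pM => //; first exact: HG.
    rewrite !mxE ltW// Hdl ?g1//.
    rewrite ger0_norm ?subr_ge0//; apply: le_lt_trans hn.
    by rewrite -(gS n j) lerD2l lerN2.
rewrite sum_ord_const -[ltLHS]mulrA divfK//.
rewrite (_ : _ * om * t = (d%:R * G * t) * e / (d%:R * G * t + 1)); last by rewrite
    /om; ring.
rewrite ltr_pdivrMr; last by rewrite ltr_wpDl.
by rewrite [ltRHS]mulrC mulrDl mul1r ltrDl.
Unshelve. all: by end_near. Qed.

End RiemannSums.

(** * Chaining *)

Section Chaining.
Context {R : realType}.
Variables (T rho : R) (K : nat) (g : R -> R).
Hypotheses (T0 : 0 < T) (rho0 : 0 < rho) (rho1 : rho < 1).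
Hypothesis gc : {within `[0, T[, continuous g}.

Definition dyadic (T : R) (k j : nat) : R := j%:R * (T / 2 ^+ k).

Hypothesis gK : forall k j, (K <= k)%N -> (j.+1 < 2 ^ k)%N ->
  `|g (dyadic T k j.+1) - g (dyadic T k j)| <= rho ^+ k.

Let tau n : R := T - T / 2 ^+ n.

Lemma dyadicS k j : dyadic T k j = dyadic T k.+1 j.*2.
Proof. by rewrite /dyadic -muln2 natrM exprS; field. Qed.

(** Binary expansion of [t]: the index [j] marks the cell of level [n + i] that contains [t].
    Halving a cell keeps its left end or moves it by one mesh step, at a cost of at most
    rho^(n+i+1), and the costs form a geometric sum. No step reaches [T], where [g] is not
    controlled. *)
Lemma dyadic_chain n i t : (K <= n)%N -> tau n <= t -> t < T ->
  exists2 j, (j < 2 ^ (n + i))%N &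
    dyadic T (n + i) j <= t < dyadic T (n + i) j.+1 /\
    `|g (dyadic T (n + i) j) - g (tau n)| <=
       rho ^+ n.+1 * ((1 - rho ^+ i) / (1 - rho)).
Proof.
move=> Kn nt tT; elim: i => [|i [j j2 [/andP[jt tj] hj]]].
  (* The last cell of level [n] starts at [tau n] and ends at [T]. *)
  exists (2 ^ n).-1; first by rewrite addn0 prednK// expn_gt0.
  have e : dyadic T n (2 ^ n).-1 = tau n.
    rewrite /dyadic -subn1 natrB ?expn_gt0// natrX /tau.
    by field.
  rewrite addn0 e nt prednK ?expn_gt0//; split.
    by rewrite /dyadic natrX (_ : _ * _ = T)//; field.
  by rewrite subrr normr0 expr0 subrr mul0r mulr0.
have r1 : 1 - rho != 0 by rewrite gt_eqF// subr_gt0.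
have mono : rho ^+ n.+1 * ((1 - rho ^+ i) / (1 - rho)) + rho ^+ (n + i.+1) =
    rho ^+ n.+1 * ((1 - rho ^+ i.+1) / (1 - rho)).
  by rewrite addnS -addSn exprD [rho ^+ i.+1]exprS; field.
have [tm|mt] := ltP t (dyadic T (n + i.+1) j.*2.+1).
  exists j.*2; first by rewrite addnS expnS mul2n ltn_double.
  rewrite tm andbT addnS -dyadicS jt; split => //.
  apply: (le_trans hj); rewrite -mono lerDl exprn_ge0// ltW//.
have jj : (j.*2.+1 < 2 ^ (n + i.+1))%N.
  by rewrite addnS expnS mul2n ltn_Sdouble.
have tj' : t < dyadic T (n + i.+1) j.*2.+2.
  by rewrite addnS (_ : j.*2.+2 = j.+1.*2)// -dyadicS.
exists j.*2.+1 => //; split; first by rewrite mt.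
rewrite -mono (_ : _ - _ = (g (dyadic T (n + i.+1) j.*2.+1) - g (dyadic T (n + i.+1)
    j.*2))
  + (g (dyadic T (n + i) j) - g (tau n))); last first.
  by rewrite addnS -dyadicS; ring.
apply: (le_trans (ler_normD _ _)); rewrite [leRHS]addrC lerD//.
by apply: gK => //; apply: (leq_trans Kn); rewrite leq_addr.
Qed.

Let c := rho / (1 - rho).

Let tau_ge0 n : 0 <= tau n.
Proof.
rewrite subr_ge0 ler_pdivrMr ?exprn_gt0// ler_peMr ?(ltW T0)//.
by rewrite exprn_ege1 // ler1n.
Qed.

Let tau_lt n : tau n < T.
Proof. by rewrite ltrBlDr ltrDl divr_gt0// exprn_gt0. Qed.

Let half_cvg (x : R) : x / 2 ^+ n @[n --> \oo] --> (0 : R).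
Proof.
rewrite -(mulr0 x); apply: cvgMr.
under eq_fun do rewrite -exprVn.
apply: cvg_expr; rewrite ger0_norm ?invr_ge0// invf_lt1// ltr1n//.
Qed.

(** The left ends of the cells tend to [t], where [g] is continuous; [c * rho ^+ n] is the full
    geometric tail from rho^(n+1) on. *)
Lemma chaining_dist n t : (K <= n)%N -> tau n <= t -> t < T ->
  `|g t - g (tau n)| <= c * rho ^+ n.
Proof.
move=> Kn nt tT; apply/ler_addgt0Pr => e e0.
have t0T : `[0, T[%classic t by rewrite /= in_itv/= (le_trans (tau_ge0 n)).
have [dl dl0 hdl] := within_continuous_dist gc t0T e0.
have [i hi] : exists i, T / 2 ^+ i < dl.
  have /cvgrPdist_lt/(_ dl dl0)[i _ hi] := half_cvg T.
  exists i; have := hi i (leqnn _); rewrite sub0r normrN; apply: le_lt_trans.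
  exact: ler_norm.
have [j j2 [/andP[jt tj] hj]] := dyadic_chain i Kn nt tT.
have jd : 0 <= dyadic T (n + i) j by rewrite /dyadic mulr_ge0// divr_ge0 ?ltW// exprn_ge0.
have h1 : `|g t - g (dyadic T (n + i) j)| < e.
  apply: hdl; first by rewrite /= in_itv/= jd (le_lt_trans jt).
  rewrite ger0_norm ?subr_ge0//; apply: (le_lt_trans _ hi).
  rewrite lerBlDl (le_trans (ltW tj))// /dyadic -natr1 mulrDl mul1r lerD2l.
  rewrite ler_wpM2l ?(ltW T0)// lef_pV2 ?posrE ?exprn_gt0//.
  by rewrite ler_weXn2l ?leq_addl// ler1n.
rewrite (_ : _ - _ = (g (dyadic T (n + i) j) - g (tau n)) + (g t - g (dyadic T (n +
    i) j))); last by ring.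
rewrite (le_trans (ler_normD _ _))// lerD ?(ltW h1)// (le_trans hj)//.
rewrite (_ : _ * _ = c * rho ^+ n * (1 - rho ^+ i)); last by rewrite /c exprS; ring.
have c0 : 0 < c by rewrite divr_gt0// subr_gt0.
rewrite ler_piMr//; first by rewrite mulr_ge0 ?exprn_ge0 ?(ltW c0) ?(ltW rho0).
by rewrite lerBlDr lerDl exprn_ge0 ?(ltW rho0).
Qed.

Lemma chaining_endpoint : exists l, forall n t, (K <= n)%N -> tau n <= t -> t < T ->
  `|g t - l| <= 2 * c * rho ^+ n.
Proof.
have tauS m n : (m <= n)%N -> tau m <= tau n.
  move=> mn; rewrite lerD2l lerN2 ler_wpM2l ?(ltW T0)// lef_pV2 ?posrE ?exprn_gt0//.
  by rewrite ler_weXn2l// ler1n.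
have rn : c * rho ^+ n @[n --> \oo] --> (0 : R).
  by rewrite -(mulr0 c); apply: cvgMr; apply: cvg_expr; rewrite gtr0_norm.
have cg : cvgn (g \o tau).
  apply/cauchy_cvgP/cauchyP => e e0.
  have /cvgrPdist_lt/(_ e e0)[n _ hn] := rn.
  exists (g (tau (maxn n K))); exists (maxn n K) => // m /= nm.
  rewrite /ball /= distrC; apply: le_lt_trans (hn _ (leq_maxl n K)).
  rewrite sub0r normrN (le_trans _ (ler_norm _))// chaining_dist ?leq_maxr//.
  exact: tauS.
pose l := limn (g \o tau).
have hl n : (K <= n)%N -> `|g (tau n) - l| <= c * rho ^+ n.
  move=> Kn; have : (fun m => `|g (tau n) - g (tau m)|) @ \oo --> `|g (tau n) - l|.
    by apply: cvg_norm; apply: cvgB; [exact: cvg_cst|exact: cg].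
  move=> /cvg_lim <-//; apply: limr_le.
    apply: is_cvg_norm; apply: is_cvgB => //; exact: is_cvg_cst.
  exists n => // m /= nm; rewrite distrC; apply: chaining_dist => //.
  exact: tauS.
exists l => n t Kn nt tT.
rewrite (_ : _ - _ = (g t - g (tau n)) + (g (tau n) - l)); last by ring.
rewrite (le_trans (ler_normD _ _))// -mulrA mulr_natl mulr2n lerD//.
  exact: chaining_dist.
exact: hl.
Qed.

(** For [t] between [tau n] and [tau n.+1], the distance [T - t] is at least T / 2^(n+1), whose
    power [be] is T^be rho^(n+1). The [rho] in the denominator of the constant pays for the shift
    from n to n + 1. *)
Lemma chaining_holder be : rho = 2 `^ (- be) ->
  exists l C, forall t, T - T / 2 ^+ K <= t < T -> `|g t - l| <= C * (T - t) `^ be.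
Proof.
move=> rhoE; have [l hl] := chaining_endpoint.
exists l, (2 * c / (rho * T `^ be)) => t /andP[Kt tT].
have ex : exists n, t < tau n.+1.
  have /cvgrPdist_lt/(_ (T - t)) := half_cvg T.
  rewrite subr_gt0 => /(_ tT)[n _ hn]; exists n.
  have := hn n.+1 (leqnSn _); rewrite sub0r normrN gtr0_norm ?divr_gt0 ?exprn_gt0//.
  by rewrite /tau ltrBrDl addrC -ltrBrDl.
(* Minimality gives [tau n <= t]; for [n = 0] this holds because [tau 0 = 0]. *)
have [n tn nmin] := ex_minnP ex.
have nt : tau n <= t.
  case: n tn nmin => [|n] tn nmin; first by rewrite (le_trans _ Kt)// /tau expr0
      divr1 subrr tau_ge0.
  by rewrite leNgt; apply/negP => /nmin; rewrite ltnn.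
have Kn : (K <= n)%N.
  rewrite leqNgt; apply/negP => nK; move: tn; rewrite ltNge => /negP; apply.
  apply: le_trans Kt; rewrite lerD2l lerN2 ler_wpM2l ?(ltW T0)// lef_pV2 ?posrE
      ?exprn_gt0//.
  by rewrite ler_weXn2l// ler1n.
apply: (le_trans (hl n t Kn nt tT)).
have c0 : 0 < c by rewrite divr_gt0// subr_gt0.
have hT : T / 2 ^+ n.+1 <= T - t by move: tn; rewrite /tau ltrBrDl addrC -ltrBrDl => /ltW.
have be0 : 0 < be.
  rewrite ltNge; apply/negP => be0.
  have : 2 `^ 0 <= 2 `^ (- be) :> R by apply: ler_powR; rewrite ?ler1n ?oppr_ge0.
  by rewrite powRr0 -rhoE leNgt rho1.
have : (T / 2 ^+ n.+1) `^ be <= (T - t) `^ be.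
  apply: ge0_ler_powR => //; rewrite ?nnegrE ?subr_ge0 ?(ltW be0) ?(ltW tT)//.
  by rewrite divr_ge0 ?exprn_ge0 ?(ltW T0).
have -> : (T / 2 ^+ n.+1) `^ be = T `^ be * rho ^+ n.+1.
  rewrite powRM ?invr_ge0 ?exprn_ge0 ?(ltW T0)//; congr (_ * _).
  have e2 : (2 : R) ^+ n.+1 = 2 `^ n.+1%:R by rewrite powR_mulrn.
  have er : rho ^+ n.+1 = (2 `^ (- be)) `^ n.+1%:R.
    by rewrite powR_mulrn ?powR_ge0// rhoE.
  rewrite e2 er -powRN -powRrM -powRrM.
  by congr (2 `^ _); ring.
move=> h.
have Tb : 0 < T `^ be by exact: powR_gt0.
rewrite [leRHS]mulrAC ler_pdivlMr; last by rewrite mulr_gt0.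
rewrite [leLHS](_ : _ = (2 * c) * (T `^ be * rho ^+ n.+1)); last by rewrite exprS; ring.
by rewrite ler_wpM2l// mulr_ge0// ltW.
Qed.

End Chaining.

(** * Gaussian laws *)

Section RealLaws.
Context {R : realType}.
Local Notation mu := (@lebesgue_measure R).
Local Notation RR := (measurableTypeR R).
Implicit Types (h : R -> R).

Lemma integral_normal_prob (m s : R) (f : R -> \bar R) :
  (normal_prob m s).-integrable setT f ->
  (\int[normal_prob m s]_x f x = \int[mu]_x (f x * (normal_pdf m s x)%:E))%E.
Proof.
move=> intf; have mf := measurable_int _ intf.
rewrite -(Radon_Nikodym_change_of_variables (normal_prob_dominates m s))//=.
apply: ae_eq_integral => //.
- apply: emeasurable_funM => //; apply: (measurable_int mu).
  by apply: Radon_Nikodym_integrable; exact: normal_prob_dominates.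
- apply: emeasurable_funM => //=; apply/measurable_EFinP.
  exact: measurable_normal_pdf.
- apply: ae_eqe_mul2l => /=.
  rewrite Radon_NikodymE//=; first exact: normal_prob_dominates.
  move=> abmu.
  case: cid => /= h [h1 h2 h3].
  apply: integral_ae_eq => //=.
  + by apply/measurable_EFinP; exact: measurable_normal_pdf.
  + by move=> E E01 mE; rewrite -h3.
Qed.

Lemma bounded_integrable (nu : probability RR R) h : measurable_fun setT h ->
  (forall x, 0 <= h x <= 1) -> nu.-integrable setT (EFin \o h).
Proof.
move=> mh h01; apply: (@le_integrable _ _ _ nu setT _ _ (cst 1%E)) => //.
- exact/measurable_EFinP.
- by move=> x _ /=; have /andP[h0 h1] := h01 x; rewrite ger0_norm// normr1 lee_fin.
- exact: finite_measure_integrable_cst.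
Qed.

(** This class is small enough for dominated convergence along almost sure limits and large enough
    to determine a law. *)
Definition test_function h := continuous h /\ forall x, 0 <= h x <= 1.

Lemma test_measurable h : test_function h -> measurable_fun setT h.
Proof. by move=> [ch _]; exact: continuous_measurable_fun. Qed.

Lemma continuous_clamp (k a : R) :
  continuous (fun x : R => Num.min 1 (Num.max 0 (k * (a - x)))).
Proof.
apply: min_fun_continuous; first exact: cst_continuous.
apply: max_fun_continuous; first exact: cst_continuous.
by move=> x; apply: cvgMr; apply: cvgB => //; exact: cvg_cst.
Qed.

(** The ramps [min 1 (max 0 (k (a - x)))] converge to the indicator of []-oo, a[] as [k] grows, and
    these rays form a pi-system generating the Borel sets. *)
Lemma law_eq (mu1 mu2 : probability RR R) :
  (forall h, test_function h ->
    \int[mu1]_x (h x)%:E = \int[mu2]_x (h x)%:E)%E ->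
  forall Y, measurable Y -> mu1 Y = mu2 Y.
Proof.
move=> H Y mY.
pose h a (k : nat) (x : R) := Num.min 1 (Num.max 0 (k%:R * (a - x))).
have th a k : test_function (h a k).
  split; first exact: continuous_clamp.
  by move=> x; rewrite /h ge_min lexx /= le_min ler01 le_max lexx.
have hcvg a x : (h a k x)%:E @[k --> \oo] --> (\1_(`]-oo, a[) x)%:E.
  apply: cvg_EFin; first exact: nearW.
  rewrite indicE; case: (ltP x a) => xa.
    rewrite mem_set ?in_itv//=.
    apply: cvg_near_cst.
    have [N hN] : exists N : nat, 1 <= N%:R * (a - x).
      exists (Num.truncn (a - x)^-1).+1.
      rewrite -ler_pdivrMr ?subr_gt0// mul1r ltW// truncnS_gt//.
    exists N => // k /= Nk; rewrite /h min_l// le_max; apply/orP; right.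
    by rewrite (le_trans hN)// ler_wpM2r ?subr_ge0 ?(ltW xa)// ler_nat.
  rewrite memNset; last by rewrite /= in_itv/= ltNge xa.
  rewrite (_ : (fun k => _) = cst 0); first exact: cvg_cst.
  apply/funext => k; rewrite /h max_l ?min_r//.
  by rewrite mulr_ge0_le0// subr_le0.
have lim (nu : probability RR R) a :
    (\int[nu]_x (h a k x)%:E)%E @[k --> \oo] --> nu `]-oo, a[%classic.
  rewrite (_ : nu _ = \int[nu]_x (\1_(`]-oo, a[) x)%:E)%E; last first.
    by rewrite integral_indic// setIT.
  have m1 k : measurable_fun [set: RR] (fun x : RR => (h a k x)%:E).
    by apply/measurable_EFinP; exact: test_measurable.
  have m2 : measurable_fun [set: RR] (fun x : RR => (\1_(`]-oo, a[) x)%:E : \bar R).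
    by apply/measurable_EFinP; exact: measurable_indic.
  have a1 : {ae nu, forall x : RR, [set: RR] x -> (h a k x)%:E @[k --> \oo] -->
      (\1_(`]-oo, a[) x)%:E}.
    by apply: aeW => x _; exact: hcvg.
  have a2 : {ae nu, forall (x : RR) k, [set: RR] x -> `|(h a k x)%:E| <= (EFin \o cst
      1%R) x}%E.
    apply: aeW => x k _; rewrite /= lee_fin.
    by have /andP[h0 h1] := (th a k).2 x; rewrite ger0_norm.
  by have [_ _] := dominated_convergence measurableT m1 m2 a1
    (finite_measure_integrable_cst nu 1 measurableT) a2.
apply: (@measure_unique _ R RR (@RGenInftyO.G R) (fun n => `]-oo, n%:R[%classic)
  _ _ _ _ mu1 mu2 _ _ Y mY) => //.
- exact: RGenInftyO.measurableE.
- move=> _ _ [x ->] [y ->]; exists (Num.min x y).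
  by apply/seteqP; split => z /=; rewrite !in_itv/= lt_min => /andP.
- by move=> n; exists n%:R.
- apply/seteqP; split => // x _; exists (Num.truncn `|x|).+1 => //=.
  by rewrite in_itv/= (le_lt_trans (ler_norm _))// truncnS_gt.
- move=> _ [a ->].
  have e : (fun k => \int[mu1]_x (h a k x)%:E)%E = (fun k => \int[mu2]_x (h a k x)%:E)%E.
    by apply/funext => k; exact: H.
  have l1 := lim mu1 a; rewrite e in l1.
  exact: (cvg_unique _ l1 (lim mu2 a)).
- by move=> k; rewrite (le_lt_trans (probability_le1 _ _))// ltry.
Qed.

End RealLaws.

Section GaussianConvolution.
Context {R : realType}.
Local Notation RR := (measurableTypeR R).
Local Notation mu := (@lebesgue_measure R).
Local Notation gamma := (@normal_prob R 0 1).
Implicit Types (h : R -> R).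

Lemma normal_pdf_expE (m s x : R) : 0 < s ->
  normal_pdf m s x = (Num.sqrt (pi *+ 2))^-1 / s * expR (- (x - m) ^+ 2 / (s ^+ 2 *+ 2)).
Proof.
move=> s0; rewrite normal_pdfE ?gt_eqF// /normal_fun /normal_peak; congr (_ * _).
rewrite -mulrnAr sqrtrM ?sqr_ge0// sqrtr_sqr gtr0_norm// invfM mulrC //.
Qed.

Lemma integral_test_normal (m s : R) h : test_function h ->
  (\int[normal_prob m s]_x (h x)%:E =
   \int[mu]_x (h x * normal_pdf m s x)%:E)%E.
Proof.
move=> th; rewrite integral_normal_prob; first by [].
exact: (bounded_integrable (normal_prob m s) (test_measurable th) th.2).
Qed.

Lemma integral_test_le1 (nu : probability (measurableTypeR R) R) h : test_function h ->
  (\int[nu]_x (h x)%:E <= 1)%E.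
Proof.
move=> th; apply: (@le_trans _ _ (\int[nu]_x (cst 1%E x))%E).
  apply: ge0_le_integral => //.
  - by move=> x _; rewrite lee_fin; have /andP[] := th.2 x.
  - by apply/measurable_EFinP; exact: test_measurable.
  - by move=> x _; rewrite lee_fin; have /andP[] := th.2 x.
by rewrite integral_cst//= probability_setT mule1.
Qed.

Lemma test_function_affine h (m s : R) : test_function h ->
  test_function (fun x => h (m + s * x)).
Proof.
move=> [ch h01]; split => [x|x]; last exact: h01.
apply: (continuous_comp (f := fun x => m + s * x)); last exact: ch.
by apply: cvgD; [exact: cvg_cst|apply: cvgMr; exact: cvg_id].
Qed.

Lemma normal_affine (m s : R) h : 0 < s -> test_function h ->
  (\int[gamma]_x (h (m + s * x))%:E = \int[normal_prob m s]_x (h x)%:E)%E.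
Proof.
move=> s0 th.
rewrite (integral_test_normal 0 1 (test_function_affine m s th)).
rewrite (integral_test_normal m s th).
pose F (x : R) := m + s * x.
have dF (x : R) : is_derive x 1 F s.
  have h1 := is_deriveD (is_derive_cst m x 1) (is_deriveZ s (is_derive_id x (1 : R))).
  by apply: (is_derive_eq h1); rewrite add0r /GRing.scale /= mulr1.
have F'E : derive1 F = cst s.
  by apply/funext => x; rewrite derive1E; have [_ ->] := dF x.
rewrite [RHS](@increasing_ge0_integration_by_substitutionT _ F).
- apply: eq_integral => x _; congr EFin.
  rewrite !fctE F'E /cst -mulrA; congr (_ * _).
  rewrite !normal_pdf_expE// divr1 mulrAC divfK ?gt_eqF//; congr (_ * expR _).
  by rewrite /F expr1n; field; rewrite gt_eqF.
- by move=> x y xy; rewrite /F ltrD2l ltr_pM2l.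
- by rewrite F'E => x; exact: cvg_cst.
- by rewrite F'E; exact: is_cvg_cst.
- by rewrite F'E; exact: is_cvg_cst.
- by move=> x; have [] := dF x.
- exact: (cvg_comp _ _ (gt0_cvgMrNy s0 cvg_id) (cvg_addrl_Ny m)).
- exact: (cvg_comp _ _ (gt0_cvgMry s0 cvg_id) (cvg_addrl m)).
- by move=> x; apply: cvgM; [exact: th.1|apply: continuous_normal_pdf; rewrite gt_eqF].
- by move=> x; rewrite mulr_ge0 ?normal_pdf_ge0//; have /andP[] := th.2 x.
Qed.

Lemma lebesgue_integral_opp (g : measurableTypeR R -> \bar R) :
  measurable_fun setT g -> (forall x, 0 <= g x)%E ->
  (\int[mu]_x g (- x)%R = \int[mu]_x g x)%E.
Proof.
move=> mg g0.
transitivity (\int[mu]_(x in (-%R : _ -> measurableTypeR R) @^-1` setT) (g \o -%R) x)%E.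
  by rewrite preimage_setT.
rewrite -ge0_integral_pushforward//=.
by apply: eq_measure_integral => //= A mA _; exact: lebesgue_measureN.
Qed.

Lemma normal_opp h : test_function h ->
  (\int[gamma]_x (h (- x))%:E = \int[gamma]_x (h x)%:E)%E.
Proof.
move=> th.
have th' : test_function (fun x => h (- x)).
  have -> : (fun x => h (- x)) = (fun x => h (0 + (- 1) * x)).
    by apply/funext => x; rewrite add0r mulN1r.
  exact: test_function_affine.
rewrite (integral_test_normal 0 1 th') (integral_test_normal 0 1 th).
rewrite -[RHS]lebesgue_integral_opp; last 2 first.
- apply/measurable_EFinP; apply: measurable_funM; first exact: test_measurable.
  exact: measurable_normal_pdf.
- by move=> x; rewrite lee_fin mulr_ge0 ?normal_pdf_ge0//; have /andP[] := th.2 x.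
apply: eq_integral => x _; rewrite !normal_pdf_expE//.
by rewrite !subr0 sqrrN.
Qed.

(** Symmetry of the standard normal law; it reduces the convolution to a positive second
    coefficient. *)
Lemma normal_abs (m b : R) h : test_function h ->
  (\int[gamma]_x (h (m + `|b| * x))%:E = \int[gamma]_x (h (m + b * x))%:E)%E.
Proof.
move=> th; have [b0|b0] := leP 0 b; first by rewrite ger0_norm.
rewrite ltr0_norm// -[RHS]normal_opp; last exact: test_function_affine.
by apply: eq_integral => x _; rewrite mulrN mulNr.
Qed.

(** Completing the square. For independent standard normal x, y and z = a x + b y, the joint density
    of (x, z) is factored in two ways: z given x times x, and z times x given z. *)
Lemma normal_pdf_convol (a b x z : R) : 0 < b ->
  let c := Num.sqrt (a ^+ 2 + b ^+ 2) in
  normal_pdf (a * x) b z * normal_pdf 0 1 x =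
  normal_pdf 0 c z * normal_pdf (a * z / c ^+ 2) (b / c) x.
Proof.
move=> b0 c.
have c0 : 0 < c by rewrite sqrtr_gt0 ltr_wpDl ?sqr_ge0// exprn_gt0.
have c2 : c ^+ 2 = a ^+ 2 + b ^+ 2 by rewrite sqr_sqrtr// addr_ge0 ?sqr_ge0.
rewrite !normal_pdf_expE ?divr_gt0//.
rewrite mulrACA [RHS]mulrACA -!expRD; congr (_ * expR _).
  by field; rewrite !gt_eqF//= sqrtr_gt0 mulrn_wgt0 ?pi_gt0.
have c2n : a ^+ 2 + b ^+ 2 != 0 by rewrite -c2 expf_eq0 gt_eqF.
rewrite !exprMn exprVn c2 subr0 expr1n.
by field; rewrite c2n gt_eqF.
Qed.

(** At fixed [x] the inner variable is changed to z = a x + b y; once the integrals are exchanged,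
    the conditional density of [x] given [z] integrates to 1. *)
Lemma gauss_convol (a b : R) h : test_function h ->
  (\int[gamma]_x \int[gamma]_y (h (a * x + b * y))%:E =
   \int[gamma]_x (h (Num.sqrt (a ^+ 2 + b ^+ 2) * x))%:E)%E.
Proof.
move=> th.
have th' y m := test_function_affine y m th.
(* For [b = 0] there is no conditional density of [z]; the claim is then the symmetry between [a]
   and its absolute value. *)
have [->|b0] := eqVneq b 0.
  rewrite expr0n addr0 sqrtr_sqr.
  have := normal_abs 0 a th.
  under eq_integral do rewrite add0r.
  move=> ->; apply: eq_integral => x _.
  under eq_integral do rewrite mul0r.
  by rewrite integral_cst//= probability_setT mule1 add0r addr0.
wlog b1 : b b0 / 0 < b.
  move=> H; have := H `|b|; rewrite normr_eq0 normr_gt0 real_normK ?num_real// => /(_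
      b0 b0) <-.
  by apply: eq_integral => x _; rewrite normal_abs.
set c := Num.sqrt _.
have c0 : 0 < c by rewrite sqrtr_gt0 ltr_wpDl ?sqr_ge0// exprn_gt0.
transitivity (\int[normal_prob 0%R c]_x (h x)%:E)%E; last first.
  rewrite -(normal_affine 0 c0 th).
  by apply: eq_integral => x _; rewrite add0r.
rewrite (integral_test_normal 0 c th).
have mf : measurable_fun setT (fun xz : RR * RR =>
    (h xz.2 * (normal_pdf (a * xz.1) b xz.2 * normal_pdf 0 1 xz.1))%:E).
  apply/measurable_EFinP; apply: measurable_funM.
    by apply: measurableT_comp => //; exact: test_measurable.
  apply: measurable_funM; last first.
    by apply: measurableT_comp => //; exact: measurable_normal_pdf.
  (* Joint measurability becomes visible once the density is a fixed function of [z - a x]. *)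
  rewrite (_ : (fun _ => _) = fun xz : RR * RR => normal_pdf 0 b (xz.2 - a * xz.1));
      last first.
    by apply/funext => xz; rewrite !normal_pdf_expE// subr0.
  apply: measurableT_comp; first exact: measurable_normal_pdf.
  by apply: measurable_funB => //; exact: measurable_funM.
have f0 (xz : RR * RR) : (0 <= (h xz.2 * (normal_pdf (a * xz.1) b xz.2 * normal_pdf 0
    1 xz.1))%:E)%E.
  by rewrite lee_fin !mulr_ge0 ?normal_pdf_ge0//; have /andP[] := th.2 xz.2.
transitivity (\int[mu]_x \int[mu]_z
   (h z * (normal_pdf (a * x) b z * normal_pdf 0 1 x))%:E)%E; last first.
  rewrite [LHS](@fubini_tonelli _ _ _ _ _ mu mu _ mf f0).
  apply: eq_integral => z _ /=.
  under eq_integral do rewrite normal_pdf_convol// mulrA EFinM.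
  rewrite ge0_integralZl//=.
  - by rewrite integral_normal_pdf mule1.
  - by apply/measurable_EFinP; exact: measurable_normal_pdf.
  - by move=> x _; rewrite lee_fin normal_pdf_ge0.
  - by rewrite lee_fin mulr_ge0 ?normal_pdf_ge0//; have /andP[] := th.2 z.
have inner x : (\int[gamma]_y (h (a * x + b * y))%:E =
   \int[mu]_z (h z * normal_pdf (a * x) b z)%:E)%E.
  by rewrite (normal_affine _ b1 th) (integral_test_normal _ _ th).
have im : measurable_fun [set: RR] (fun x : RR => \int[mu]_z (h z * normal_pdf (a *
    x) b z)%:E)%E.
  have mg : measurable_fun setT (fun xz : RR * RR => (h xz.2 * normal_pdf (a * xz.1)
      b xz.2)%:E).
    apply/measurable_EFinP; apply: measurable_funM.
      by apply: measurableT_comp => //; exact: test_measurable.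
    rewrite (_ : (fun _ => _) = fun xz : RR * RR => normal_pdf 0 b (xz.2 - a *
        xz.1)); last first.
      by apply/funext => xz; rewrite !normal_pdf_expE// subr0.
    apply: measurableT_comp; first exact: measurable_normal_pdf.
    by apply: measurable_funB => //; exact: measurable_funM.
  have g0 (xz : RR * RR) : (0 <= (h xz.2 * normal_pdf (a * xz.1) b xz.2)%:E)%E.
    by rewrite lee_fin mulr_ge0 ?normal_pdf_ge0//; have /andP[] := th.2 xz.2.
  exact: (@measurable_fun_fubini_tonelli_F _ _ RR RR R mu _ mg g0).
under eq_integral do rewrite inner.
rewrite integral_normal_prob; last first.
  apply: (@le_integrable _ _ _ gamma setT _ _ (cst 1%E)) => //.
    move=> x _ /=; rewrite -inner.
    rewrite gee0_abs; last by apply: integral_ge0 => y _; rewrite lee_fin; have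
        /andP[] := th.2 (a * x + b * y).
    by rewrite normr1 integral_test_le1//; exact: test_function_affine.
  exact: finite_measure_integrable_cst.
apply: eq_integral => x _.
have mhp : measurable_fun [set: RR] (fun z : RR => (h z * normal_pdf (a * x) b z)%:E).
  apply/measurable_EFinP; apply: measurable_funM; first exact: test_measurable.
  exact: measurable_normal_pdf.
have hp0 (z : RR) : setT z -> (0 <= (h z * normal_pdf (a * x) b z)%:E)%E.
  by rewrite lee_fin mulr_ge0 ?normal_pdf_ge0//; have /andP[] := th.2 z.
have p0 : (0 <= (normal_pdf 0 1 x)%:E)%E by rewrite lee_fin normal_pdf_ge0.
rewrite muleC -(ge0_integralZl mu measurableT mhp hp0 p0).
by apply: eq_integral => z _; rewrite -EFinM; congr EFin; ring.
Qed.

End GaussianConvolution.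

(** * Regularity of Gaussian increments at the endpoint *)

Section GaussianTail.
Context {R : realType}.
Local Notation RR := (measurableTypeR R).
Local Notation mu := (@lebesgue_measure R).

(* For [|x| > lam] the density of N(0, s^2) at [x] is at most
   [sqrt 2 exp (- lam^2 / (4 s^2))] times that of N(0, 2 s^2). *)
Lemma normal_tail (s lam : R) : 0 < s -> 0 <= lam ->
  (normal_prob 0 s [set x : R | (lam < `|x|)%R] <=
   (2 * expR (- (lam ^+ 2 / (4 * s ^+ 2))))%:E)%E.
Proof.
move=> s0 lam0.
have q2 : (0 : R) < Num.sqrt 2 by rewrite sqrtr_gt0.
have q4 : Num.sqrt 2 <= 2 :> R.
  rewrite -[leRHS]ger0_norm// -sqrtr_sqr ler_sqrt ?sqr_ge0//.
  by rewrite expr2 ler_peMl// ler1n.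
have mA : measurable [set x : RR | lam < `|x|].
  rewrite [X in measurable X](_ : _ = (@Num.norm _ R) @^-1` `]lam, +oo[); last first.
    by apply/seteqP; split => x /=; rewrite in_itv/= andbT.
  by rewrite -[X in measurable X]setTI; exact: normr_measurable.
pose K := 2 * expR (- (lam ^+ 2 / (4 * s ^+ 2))).
apply: (@le_trans _ _ (\int[mu]_(x in [set x : RR | (lam < `|x|)%R]) (K%:E *
    (normal_pdf 0 (Num.sqrt 2 * s) x)%:E))%E).
  rewrite /normal_prob; apply: ge0_le_integral => //.
  - by move=> x _; rewrite lee_fin normal_pdf_ge0.
  - by apply/measurable_EFinP/measurable_funTS; exact: measurable_normal_pdf.
  - apply/measurable_EFinP/measurable_funTS; apply: measurable_funM => //.
    exact: measurable_normal_pdf.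
  - move=> x /= lx.
    have lx2 : lam ^+ 2 <= x ^+ 2 :> R.
      rewrite -[leRHS](@real_normK R) ?num_real//.
      by rewrite lerXn2r ?nnegrE// ltW.
    rewrite -EFinM lee_fin !normal_pdf_expE ?mulr_gt0//.
    rewrite !subr0 /K exprMn sqr_sqrtr//.
    have -> : expR (- x ^+ 2 / (s ^+ 2 *+ 2)) =
        expR (- x ^+ 2 / (2 * s ^+ 2 *+ 2)) * expR (- (x ^+ 2 / (4 * s ^+ 2))).
      by rewrite -expRD; congr expR; field; rewrite gt_eqF.
    set e1 := expR (- x ^+ 2 / (2 * s ^+ 2 *+ 2)).
    set c := (Num.sqrt (pi *+ 2))^-1.
    have c0 : 0 <= c by rewrite invr_ge0 sqrtr_ge0.
    rewrite [leLHS](_ : _ = (c / (Num.sqrt 2 * s) * e1) *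
       (Num.sqrt 2 * expR (- (x ^+ 2 / (4 * s ^+ 2))))); last first.
      by field; rewrite !gt_eqF.
    rewrite mulrC; apply: ler_wpM2r.
      by rewrite mulr_ge0 ?expR_ge0// divr_ge0// mulr_ge0 ?ltW.
    apply: ler_pM => //; rewrite ?(ltW q2) ?expR_ge0//.
    rewrite ler_expR lerN2; apply: ler_wpM2r => //.
    by rewrite invr_ge0 mulr_ge0 ?sqr_ge0.
apply: (@le_trans _ _ (\int[mu]_x (K%:E * (normal_pdf 0 (Num.sqrt 2 * s) x)%:E))%E).
  apply: ge0_subset_integral => //.
  - apply/measurable_EFinP/measurable_funTS; apply: measurable_funM => //.
    exact: measurable_normal_pdf.
  - by move=> x _; rewrite -EFinM lee_fin mulr_ge0 ?normal_pdf_ge0// mulr_ge0// expR_ge0.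
rewrite ge0_integralZl//.
- by rewrite integral_normal_pdf mule1.
- by apply/measurable_EFinP; exact: measurable_normal_pdf.
- by move=> x _; rewrite lee_fin normal_pdf_ge0.
- by rewrite lee_fin mulr_ge0// expR_ge0.
Qed.

(** The inequality 1 + x <= e^x at x = y / p, raised to the power [p]. It turns a Gaussian tail into
    any prescribed polynomial rate. *)
Lemma expRN_le (p : nat) (y : R) : 0 < y -> (0 < p)%N ->
  expR (- y) <= p%:R ^+ p / y ^+ p.
Proof.
move=> y0 p0.
have p1 : 0 < p%:R :> R by rewrite ltr0n.
have yp : 0 < y / p%:R by rewrite divr_gt0.
have -> : - y = - (y / p%:R) * p%:R by field; rewrite gt_eqF.
rewrite expRM_natr -expr_div_n; apply: lerXn2r.
- by rewrite nnegrE expR_ge0.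
- by rewrite nnegrE divr_ge0 ?ltW.
rewrite expRN -(invf_div y) lef_pV2 ?posrE ?expR_gt0//.
by apply: (le_trans _ (expR_ge1Dx _)); rewrite lerDr.
Qed.

End GaussianTail.

Section HolderAtEndpoint.
Context {dsp : measure_display} {Omega : measurableType dsp} {R : realType}.
Variable P : probability Omega R.

Lemma expr_unbounded (th a : R) : 1 < th -> exists p, a <= th ^+ p.
Proof.
move=> th1; pose p := (Num.truncn (`|a| / (th - 1))).+1.
exists p; have t0 : 0 < th - 1 by rewrite subr_gt0.
have h (n : nat) : n%:R * (th - 1) <= th ^+ n.
  elim: n => [|n IH]; first by rewrite mul0r expr0.
  have : 1 <= th ^+ n by rewrite exprn_ege1// ltW.
  by rewrite exprS -natr1; nra.
apply: (le_trans _ (h p)); rewrite (le_trans (ler_norm _))// -ler_pdivrMr//.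
by rewrite ltW// truncnS_gt.
Qed.

Lemma holder_at_endpoint (T be : R) (b : R -> Omega -> R) :
  0 < T -> 0 < be < 1 / 2 ->
  (forall t, 0 <= t < T -> measurable_fun setT (b t)) ->
  (forall s t lam : R, 0 <= s -> s < t -> t < T -> 0 <= lam ->
    (P [set w | (lam < `|b t w - b s w|)%R] <=
     normal_prob 0 (Num.sqrt (t - s)) [set x : R | (lam < `|x|)%R])%E) ->
  {ae P, forall w, {within `[0, T[, continuous (fun t => b t w)}} ->
  {ae P, forall w, exists (l C : R) (K : nat), forall t,
    T - T / 2 ^+ K <= t < T -> `|b t w - l| <= C * (T - t) `^ be}.
Proof.
move=> T0 /andP[be0 be1] mb bN bc.
pose rho : R := 2 `^ (- be).
have rho0 : 0 < rho by rewrite powR_gt0.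
have rho1 : rho < 1.
  rewrite /rho powRN invf_lt1 ?powR_gt0// -[ltLHS](powRr0 2).
  by rewrite /powR pnatr_eq0 /= ltr_expR mul0r mulr_gt0// ln_gt0// ltr1n.
(* At level [k] the squared threshold rho^(2k) divided by the variance T / 2^k is th^k / T, which
   grows because [be < 1/2]. *)
pose th := 2 * rho ^+ 2.
have th1 : 1 < th.
  have -> : th = 2 `^ (1 - 2 * be).
    rewrite /th /rho -powR_mulrn ?powR_ge0// -powRrM powRD; last first.
      by apply/implyP => _; rewrite pnatr_eq0.
    by rewrite powRr1//; congr (_ * (2 `^ _)); ring.
  rewrite -[ltLHS](powRr0 2) /powR pnatr_eq0 /= ltr_expR mul0r mulr_gt0//; last first.
    by rewrite ln_gt0// ltr1n.
  by rewrite subr_gt0; lra.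
(* With [4 <= th ^+ p] each tail of level [k] is at most C / 4^k, against fewer than 2^k
   increments. *)
have [p hp] := expr_unbounded 4 th1.
have p0 : (0 < p)%N.
  by case: p hp => //; rewrite expr0; lra.
pose dt k : R := T / 2 ^+ k.
have dt0 k : 0 < dt k by rewrite divr_gt0// exprn_gt0.
have dyE k j : dyadic T k j.+1 - dyadic T k j = dt k.
  by rewrite /dyadic -mulrBl -natrB// subSnn mul1r.
have dyP k j : (j < 2 ^ k)%N -> 0 <= dyadic T k j < T.
  move=> jk; rewrite /dyadic mulr_ge0 ?(ltW (dt0 k))//= mulrA ltr_pdivrMr ?exprn_gt0//.
  by rewrite mulrC ltr_pM2l// -natrX ltr_nat.
(* The first clause discards the increment ending at [T], where [b] is not controlled; out of range
   [A k j] is empty. *)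
pose A k j := [set w | (j.+1 < 2 ^ k)%N /\ (rho ^+ k < `|b (dyadic T k j.+1) w - b
    (dyadic T k j) w|)%R].
have mA k j : measurable (A k j).
  have [jk|jk] := boolP (j.+1 < 2 ^ k)%N; last first.
    by rewrite (_ : A k j = set0)//; apply/seteqP; split => // w []; rewrite (negbTE jk).
  have mD : measurable_fun setT (fun w => `|b (dyadic T k j.+1) w - b (dyadic T k j) w|).
    apply: measurableT_comp => //; apply: measurable_funB; apply: mb; apply: dyP => //.
    exact: ltn_trans jk.
  rewrite (_ : A k j = (fun w => `|b (dyadic T k j.+1) w - b (dyadic T k j) w|) @^-1`
      `]rho ^+ k, +oo[); last first.
    by apply/seteqP; split => w /=; rewrite in_itv/= andbT; [case|split].
  by rewrite -[X in measurable X]setTI; apply: mD.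
pose C := 2 * (p%:R * (4 * T)) ^+ p.
have C0 : 0 <= C by rewrite mulr_ge0// exprn_ge0// mulr_ge0// mulr_ge0// ltW.
have PA k j : (P (A k j) <= (C / 4 ^+ k)%:E)%E.
  have [jk|jk] := boolP (j.+1 < 2 ^ k)%N; last first.
    rewrite (_ : A k j = set0) ?measure0 ?lee_fin ?divr_ge0 ?exprn_ge0//.
    by apply/seteqP; split => // w []; rewrite (negbTE jk).
  have /andP[d0 _] := dyP k j (ltn_trans (ltnSn _) jk).
  have /andP[_ d1] := dyP k j.+1 jk.
  have dlt : dyadic T k j < dyadic T k j.+1 by rewrite -subr_gt0 dyE.
  have r0 : 0 <= rho ^+ k by rewrite exprn_ge0 ?ltW.
  rewrite (_ : A k j = [set w | (rho ^+ k < `|b (dyadic T k j.+1) w - b (dyadic T k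
      j) w|)%R]); last first.
    by apply/seteqP; split => w //= [].
  apply: (le_trans (bN _ _ _ d0 dlt d1 r0)); rewrite dyE.
  have sq0 : 0 < Num.sqrt (dt k) by rewrite sqrtr_gt0.
  apply: (le_trans (normal_tail sq0 r0)); rewrite lee_fin sqr_sqrtr ?(ltW (dt0 k))//.
  rewrite /C -mulrA ler_pM2l//.
  set y := _ / (4 * _).
  have yE : y = th ^+ k / (4 * T).
    rewrite /y /th /dt exprMn -!exprM [(k * 2)%N]mulnC; field.
    by rewrite !gt_eqF// exprn_gt0.
  have thk : 0 < th ^+ k by rewrite exprn_gt0// (lt_trans _ th1).
  clearbody y.
  have y0 : 0 < y by rewrite yE divr_gt0 ?mulr_gt0.
  apply: (le_trans (expRN_le y0 p0)).
  rewrite exprMn -mulrA; apply: ler_wpM2l; first by rewrite exprn_ge0.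
  rewrite yE expr_div_n invf_div; apply: ler_wpM2l.
    by rewrite exprn_ge0// mulr_ge0// ltW.
  rewrite lef_pV2 ?posrE ?exprn_gt0 ?(lt_trans ltr01 th1)//.
  by rewrite -exprM mulnC exprM lerXn2r ?nnegrE// (le_trans _ hp).
clearbody C.
pose E k := \big[setU/set0]_(j < 2 ^ k) A k j.
have mE k : measurable (E k) by apply: bigsetU_measurable.
(* The union bound yields C / 2^k, written in the shape of a geometric series of known sum. *)
have PE k : (P (E k) <= (2 * C / (2 ^ (k + 1))%:R)%:E)%E.
  apply: (le_trans (Boole_inequality P _)) => //.
  apply: (@le_trans _ _ (\sum_(j < 2 ^ k) (C / 4 ^+ k)%:E)%E).
    by apply: lee_sum => j _; exact: PA.
  rewrite sumEFin lee_fin sumr_const card_ord -[leLHS]mulr_natr.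
  have e4 : (4 : R) ^+ k = 2 ^+ k * 2 ^+ k by rewrite -exprMn -natrM.
  have e2 : (2 ^ (k + 1))%:R = 2 * 2 ^+ k :> R by rewrite natrX addn1 exprS.
  have t0 : (2 : R) ^+ k != 0 by rewrite expf_neq0.
  rewrite e4 e2 natrX; set x := (2 : R) ^+ k in t0 *.
  by rewrite le_eqVlt; apply/orP; left; apply/eqP; field.
have limsup0 : P (lim_sup_set E) = 0%E.
  apply: lim_sup_set_cvg0 => //.
  apply: (@le_lt_trans _ _ (\sum_(k <oo) (2 * C / (2 ^ (k + 1))%:R)%:E)%E).
    by apply: lee_nneseries => [k _ _|k _]; [exact: measure_ge0|have := PE k].
  have /cvg_lim -> // := @cvg_geometric_eseries_half R (2 * C) 0.
  exact: ltry.
have aeE : {ae P, forall w, ~ lim_sup_set E w}.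
  exists (lim_sup_set E); split => //; last by move=> w /= /contrapT.
  by apply: bigcapT_measurable => n; apply: bigcup_measurable.
apply: filterS2 bc aeE => w wc nE.
have [K hK] : exists K, forall k, (K <= k)%N -> ~ E k w.
  apply: contrapT => H; apply: nE => n _; apply: contrapT => H'.
  by apply: H; exists n => k nk Ekw; apply: H'; exists k.
have gK k j : (K <= k)%N -> (j.+1 < 2 ^ k)%N ->
    `|b (dyadic T k j.+1) w - b (dyadic T k j) w| <= rho ^+ k.
  move=> Kk jk; rewrite leNgt; apply/negP => h; apply: (hK k Kk).
  rewrite /E -bigcup_mkord; exists j => //=; exact: ltn_trans jk.
have [l [C' hl]] := chaining_holder T0 rho0 rho1 wc gK (erefl _ : rho = 2 `^ (- be)).
by exists l, C', K.
Qed.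

End HolderAtEndpoint.

Local Opaque normal_prob.

(** * Centred Gaussian laws, possibly degenerate, and sums of independent variables *)

Section GaussianLaw.
Context {R : realType}.
Local Notation RR := (measurableTypeR R).
Local Notation gamma := (@normal_prob R 0 1).

Definition scale_fun (s : R) (x : RR) : RR := s * x.

Lemma measurable_scale_fun s : measurable_fun setT (scale_fun s).
Proof. by apply: measurable_funM; [exact: measurable_cst|exact: measurable_id]. Qed.

HB.instance Definition _ s :=
  isMeasurableFun.Build _ _ _ _ (scale_fun s) (measurable_scale_fun s).

(* The law of [s * xi] for a standard normal [xi]: unlike [normal_prob 0 s] it
   is meaningful at [s = 0], where it is a Dirac mass. *)
Definition gauss_law (s : R) : probability RR R := distribution gamma (scale_fun s).

Lemma ge0_integral_gauss_law s (f : RR -> \bar R) :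
  measurable_fun setT f -> (forall x, 0 <= f x)%E ->
  (\int[gauss_law s]_x f x = \int[gamma]_x f (s * x)%R)%E.
Proof. by move=> mf f0; exact: ge0_integral_distribution. Qed.

Lemma integral_gauss_law s (h : R -> R) : test_function h ->
  (\int[gauss_law s]_x (h x)%:E = \int[gamma]_x (h (s * x))%:E)%E.
Proof.
move=> th; apply: (@ge0_integral_gauss_law s (fun x => (h x)%:E)).
  by apply/measurable_EFinP; exact: test_measurable.
by move=> y; rewrite lee_fin; have /andP[] := th.2 y.
Qed.

Lemma gauss_law_normal s (Y : set R) : 0 < s -> measurable Y ->
  gauss_law s Y = normal_prob 0 s Y.
Proof.
move=> s0 mY; apply: (@law_eq R (gauss_law s) (normal_prob 0 s) _ Y mY) => h th.
rewrite (integral_gauss_law s th) -(normal_affine 0 s0 th).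
by apply: eq_integral => x _; rewrite add0r.
Qed.

Lemma gauss_law_normal_law s (Y : set R) : 0 <= s -> measurable Y ->
  gauss_law s Y = normal_law 0 s Y.
Proof.
rewrite /normal_law le_eqVlt => /predU1P[<- mY|s0 mY]; last first.
  by rewrite (gt_eqF s0); exact: gauss_law_normal.
rewrite eqxx diracE.
have -> : gauss_law 0 Y = gamma (scale_fun 0 @^-1` Y) by [].
have [Y0|Y0] := pselect (Y 0).
  rewrite mem_set// (_ : _ @^-1` _ = setT) ?probability_setT//.
  by apply/seteqP; split => // x _; rewrite /= /scale_fun mul0r.
rewrite memNset// (_ : _ @^-1` _ = set0) ?measure0//.
by apply/seteqP; split => // x; rewrite /= /scale_fun mul0r.
Qed.

(** Integrated against test functions, both laws pull back to the standard normal one, where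
    [gauss_convol] covers zero coefficients as well. *)
Lemma gauss_law_convol (a s b : R) (Y : set R) : measurable Y ->
  (gauss_law a \x gauss_law s)%E [set xy | Y (xy.1 + b * xy.2)] =
  gauss_law (Num.sqrt (a ^+ 2 + (b * s) ^+ 2)) Y.
Proof.
move=> mY.
pose F (xy : RR * RR) : RR := xy.1 + b * xy.2.
have mF : measurable_fun setT F.
  by apply: measurable_funD => //; exact: measurable_funM.
pose X : {mfun (RR * RR)%type >-> RR} := HB.pack F (isMeasurableFun.Build _ _ _ _ F mF).
pose Q : probability (RR * RR)%type R := (gauss_law a \x gauss_law s)%E.
change (distribution Q X Y = gauss_law (Num.sqrt (a ^+ 2 + (b * s) ^+ 2)) Y).
apply: (@law_eq R (distribution Q X) (gauss_law _) _ Y mY) => h th.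
have mh : measurable_fun [set: RR] (fun x : RR => (h x)%:E).
  by apply/measurable_EFinP; exact: test_measurable.
have h0 (x : RR) : (0 <= (h x)%:E)%E by rewrite lee_fin; have /andP[] := th.2 x.
rewrite (ge0_integral_distribution _ mh h0) (integral_gauss_law _ th).
rewrite -(gauss_convol a (b * s) th).
have mhF : measurable_fun [set: RR * RR] (fun xy : RR * RR => (h (F xy))%:E).
  exact: (measurableT_comp mh mF).
have hF0 (xy : RR * RR) : (0 <= (h (F xy))%:E)%E by exact: h0.
rewrite (@fubini_tonelli1 _ _ RR RR R (gauss_law a) (gauss_law s) _ mhF hF0).
rewrite /fubini_F.
have inner (x : RR) : (\int[gauss_law s]_y (h (F (x, y)))%:E =
    \int[gamma]_y (h (x + (b * s) * y))%:E)%E.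
  have tx := test_function_affine x b th.
  rewrite (integral_gauss_law s tx).
  by apply: eq_integral => y _; rewrite mulrA.
have mF' := @measurable_fun_fubini_tonelli_F _ _ RR RR R (gauss_law s) _ mhF hF0.
etransitivity.
  apply: (ge0_integral_gauss_law a mF') => x.
  by apply: integral_ge0 => y _; exact: hF0.
by apply: eq_integral => x _; rewrite /fubini_F inner.
Qed.

End GaussianLaw.

Section GaussianVariables.
Context {dsp : measure_display} {Omega : measurableType dsp} {R : realType}.
Variable P : probability Omega R.
Local Notation RR := (measurableTypeR R).

(** The event [D] stands for conditions on further independent variables; keeping it makes the
    result usable in an induction on the number of summands. Conditionally on [D] the pair has
    product values on rectangles, hence the product law. *)
Lemma gauss_add (U W : Omega -> R) (D : set Omega) (a s b : R) :
  measurable_fun setT U -> measurable_fun setT W -> measurable D ->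
  (forall Y1 Y2, measurable Y1 -> measurable Y2 ->
    P (U @^-1` Y1 `&` W @^-1` Y2 `&` D) = (gauss_law a Y1 * gauss_law s Y2 * P D)%E) ->
  forall Y, measurable Y ->
    P ((fun w => U w + b * W w) @^-1` Y `&` D) =
    (gauss_law (Num.sqrt (a ^+ 2 + (b * s) ^+ 2)) Y * P D)%E.
Proof.
move=> mU mW mD H Y mY.
have mYD : measurable ((fun w => U w + b * W w) @^-1` Y `&` D).
  apply: measurableI => //; rewrite -[X in measurable X]setTI.
  have mUW : measurable_fun setT (fun w => U w + b * W w).
    by apply: measurable_funD => //; exact: measurable_funM.
  exact: mUW.
(* Conditioning requires P(D) > 0; otherwise both sides are 0. *)
have [PD0|PD0] := eqVneq (P D) 0%E.
  rewrite PD0 mule0; apply/eqP; rewrite -measure_le0 -PD0; apply: le_measure; rewrite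
      ?inE//.
have PDfin : P D \is a fin_num by exact: fin_num_measure.
have PDpos : (0 < fine (P D))%R.
  by rewrite fine_gt0// lt0e PD0 measure_ge0 /= ltey_eq PDfin.
pose V (w : Omega) : RR * RR := (U w, W w).
have mV : measurable_fun setT V by apply/measurable_fun_prod.
have r0 : (0 <= (fine (P D))^-1)%R by rewrite invr_ge0 ltW.
pose m0 : {measure set (RR * RR) -> \bar R} :=
  mscale (NngNum r0) (pushforward (mrestr P mD) V).
pose m' := m0 mV.
have m'E A B : measurable A -> measurable B ->
    m' (A `*` B) = (gauss_law a A * gauss_law s B)%E.
  move=> mA mB; rewrite /m' /m0 /= /mscale /= /pushforward /mrestr.
  rewrite (_ : _ @^-1` _ = U @^-1` A `&` W @^-1` B)//.
  rewrite H// -[in RHS](mule1 (_ * _)%E) muleCA; congr (_ * _)%E.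
  by rewrite -(fineK PDfin) -EFinM mulVf// gt_eqF.
have mX : measurable [set xy : RR * RR | Y (xy.1 + b * xy.2)].
  have mF : measurable_fun setT (fun xy : RR * RR => xy.1 + b * xy.2 : RR).
    by apply: measurable_funD => //; exact: measurable_funM.
  by rewrite -[X in measurable X]setTI; exact: mF.
have := product_measure_unique m'E mX.
rewrite gauss_law_convol// => ->.
rewrite /m' /m0 /= /mscale /= /pushforward /mrestr muleAC.
by rewrite -{2}(fineK PDfin) -EFinM mulVf ?gt_eqF// mul1e.
Qed.

End GaussianVariables.

Section GaussianSums.
Context {dsp : measure_display} {Omega : measurableType dsp} {R : realType}.
Variable P : probability Omega R.
Local Notation RR := (measurableTypeR R).
Local Notation gamma := (@normal_prob R 0 1).

Lemma gauss_law0 (Y : set R) : measurable Y -> gauss_law 0 Y = (\1_Y 0)%:E.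
Proof. by move=> mY; rewrite gauss_law_normal_law// /normal_law eqxx. Qed.

(** The induction strengthens the claim: the sum of the first [k] terms is considered jointly with
    an arbitrary rectangle event on the variables of index at least [k]. *)
Lemma gauss_sum (n : nat) (W : nat -> Omega -> R) (sg c : nat -> R) :
  (forall l, measurable_fun setT (W l)) ->
  (forall Y : nat -> set R, (forall l, measurable (Y l)) ->
    P [set w | forall l, (l < n)%N -> Y l (W l w)] =
    (\prod_(0 <= l < n) gauss_law (sg l) (Y l))%E) ->
  forall Y, measurable Y ->
    P ((fun w => \sum_(0 <= l < n) c l * W l w) @^-1` Y) =
    gauss_law (Num.sqrt (\sum_(0 <= l < n) (c l * sg l) ^+ 2)) Y.
Proof.
move=> mW H.
pose E (Y : nat -> set R) k := [set w | forall l, (k <= l < n)%N -> Y l (W l w)].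
have mE Y k : (forall l, measurable (Y l)) -> measurable (E Y k).
  move=> mY; rewrite (_ : E Y k = \bigcap_l (if (k <= l < n)%N then W l @^-1` Y l
      else setT)).
    apply: bigcapT_measurable => l; case: ifP => // _.
    by rewrite -[X in measurable X]setTI; exact: mW.
  apply/seteqP; split => w /= h l.
    by move=> _; case: ifP => // /h.
  by move=> kl; have := h l Logic.I; rewrite kl.
pose U k w := \sum_(0 <= l < k) c l * W l w.
have mU k : measurable_fun setT (U k).
  apply: measurable_sum => l; exact: measurable_funM.
pose s k := Num.sqrt (\sum_(0 <= l < k) (c l * sg l) ^+ 2).
have C k : (k <= n)%N -> forall (Y0 : set R) Y, measurable Y0 -> (forall l,
    measurable (Y l)) ->
    P (U k @^-1` Y0 `&` E Y k) =
    (gauss_law (s k) Y0 * \prod_(k <= l < n) gauss_law (sg l) (Y l))%E.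
  elim: k => [_|k IH kn] Y0 Y mY0 mY.
    rewrite /s big_geq// sqrtr0 gauss_law0// indicE.
    have U0 : U 0%N = cst 0 by apply/funext => w; rewrite /U big_geq.
    rewrite U0; have [Y00|Y00] := pselect (Y0 0).
      rewrite mem_set// mul1e -H//; congr (P _).
      by apply/seteqP; split => [w [_ h]|w h]//.
    rewrite memNset// mul0e (_ : _ `&` _ = set0) ?measure0//.
    by apply/seteqP; split => [w []|].
  (* Choosing [setT] for the partial sum and for the variable of index [k] leaves the marginal law
     of the later variables. *)
  have PE : P (E Y k.+1) = (\prod_(k.+1 <= l < n) gauss_law (sg l) (Y l))%E.
    have := IH (ltnW kn) setT (fun l => if l == k then setT else Y l) measurableT.
    rewrite preimage_setT setTI probability_setT mul1e big_ltn// eqxx.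
    rewrite (probability_setT (gauss_law _)) mul1e => h.
    transitivity (P (E (fun l => if l == k then setT else Y l) k)).
      congr (P _); apply/seteqP; split => w /= hw l /andP[kl ln].
        by case: eqP => // /eqP lk; apply: hw; rewrite ltn_neqAle eq_sym lk kl.
      by have := hw l; rewrite (ltnW kl) ln gtn_eqF//; apply.
    rewrite h; last by move=> l; case: ifP.
    by apply: eq_big_nat => l /andP[kl _]; rewrite gtn_eqF.
  have step (Y1 Y2 : set R) : measurable Y1 -> measurable Y2 ->
      P (U k @^-1` Y1 `&` W k @^-1` Y2 `&` E Y k.+1) =
      (gauss_law (s k) Y1 * gauss_law (sg k) Y2 * P (E Y k.+1))%E.
    move=> mY1 mY2.
    have := IH (ltnW kn) Y1 (fun l => if l == k then Y2 else Y l) mY1.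
    rewrite big_ltn// eqxx PE -muleA => h.
    transitivity (P (U k @^-1` Y1 `&` E (fun l => if l == k then Y2 else Y l) k)).
      rewrite -setIA; congr (P (_ `&` _)); apply/seteqP; split => w /=.
        move=> [h2 hw] l /andP[kl ln]; case: eqP => [->//|/eqP lk].
        by apply: hw; rewrite ltn_neqAle eq_sym lk kl.
      move=> hw; split; first by have := hw k; rewrite leqnn kn eqxx; apply.
      by move=> l /andP[kl ln]; have := hw l; rewrite (ltnW kl) ln gtn_eqF//; apply.
    rewrite h; last by move=> l; case: ifP.
    congr (_ * (_ * _))%E.
    by apply: eq_big_nat => l /andP[kl _]; rewrite gtn_eqF.
  have := gauss_add (c k) (mU k) (mW k) (mE Y k.+1 mY) step mY0.
  rewrite PE /s sqr_sqrtr; last by apply: sumr_ge0 => l _; exact: sqr_ge0.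
  rewrite big_nat_recr//= => <-; congr (P (_ `&` _)).
  by apply/seteqP; split => w /=; rewrite /U big_nat_recr.
move=> Y mY; have := C n (leqnn n) Y (fun=> setT) mY (fun=> measurableT).
rewrite big_geq// mule1 => <-; congr (P _).
by apply/seteqP; split => w //= [].
Qed.

End GaussianSums.

Section GaussianLimits.
Context {dsp : measure_display} {Omega : measurableType dsp} {R : realType}.
Variable P : probability Omega R.
Local Notation RR := (measurableTypeR R).
Local Notation gamma := (@normal_prob R 0 1).

Lemma integral_law (Z : Omega -> R) (s : R) (h : R -> R) :
  measurable_fun setT Z -> test_function h ->
  (forall Y, measurable Y -> P (Z @^-1` Y) = gauss_law s Y) ->
  (\int[P]_w (h (Z w))%:E = \int[gamma]_x (h (s * x))%:E)%E.
Proof.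
move=> mZ th H.
pose X : {mfun Omega >-> RR} := HB.pack (Z : Omega -> RR) (isMeasurableFun.Build _ _
    _ _ (Z : Omega -> RR) mZ).
rewrite -integral_gauss_law//.
have <- : (\int[distribution P X]_x (h x)%:E = \int[P]_w (h (Z w))%:E)%E.
  apply: (@ge0_integral_distribution _ _ _ _ _ P X (fun x => (h x)%:E)).
    by apply/measurable_EFinP; exact: test_measurable.
  by move=> y; rewrite lee_fin; have /andP[] := th.2 y.
by apply: eq_measure_integral => A mA _; exact: H.
Qed.

Lemma law_integral (Z : Omega -> R) (s : R) :
  measurable_fun setT Z ->
  (forall h, test_function h ->
    \int[P]_w (h (Z w))%:E = \int[gamma]_x (h (s * x))%:E)%E ->
  forall Y, measurable Y -> P (Z @^-1` Y) = gauss_law s Y.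
Proof.
move=> mZ H Y mY.
pose X : {mfun Omega >-> RR} := HB.pack (Z : Omega -> RR) (isMeasurableFun.Build _ _
    _ _ (Z : Omega -> RR) mZ).
apply: (@law_eq R (distribution P X) (gauss_law s) _ Y mY) => h th.
rewrite integral_gauss_law// -H//.
apply: (@ge0_integral_distribution _ _ _ _ _ P X (fun x => (h x)%:E)).
  by apply/measurable_EFinP; exact: test_measurable.
by move=> y; rewrite lee_fin; have /andP[] := th.2 y.
Qed.

End GaussianLimits.

(** * Almost sure limits of centred Gaussian variables *)

Section GaussianLimit.
Context {dsp : measure_display} {Omega : measurableType dsp} {R : realType}.
Variable P : probability Omega R.
Local Notation RR := (measurableTypeR R).
Local Notation mu := (@lebesgue_measure R).
Local Notation gamma := (@normal_prob R 0 1).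

(** Its integral against the law of deviation [s] is (1 + s^2)^(-1/2), strictly decreasing in
    [s >= 0], so this single function identifies the deviation. *)
Definition gauss_test (x : R) : R := expR (- (x ^+ 2 / 2)).

Lemma gauss_test_function : test_function gauss_test.
Proof.
split => [x|x].
  apply: (continuous_comp (f := fun x : R => - (x ^+ 2 / 2))); last exact:
      continuous_expR.
  by apply: cvgN; apply: cvgMl; exact: exprn_continuous.
by rewrite expR_ge0 /= -expR0 ler_expR oppr_le0 divr_ge0// sqr_ge0.
Qed.

(** Times the standard density, the integrand is [q^-1] times the density of deviation [q^-1], where
    q^2 = 1 + s^2. *)
Lemma integral_gauss_test (s : R) :
  (\int[gamma]_x (gauss_test (s * x))%:E = ((Num.sqrt (1 + s ^+ 2))^-1)%:E)%E.
Proof.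
set q := Num.sqrt _.
have q2 : q ^+ 2 = 1 + s ^+ 2 by rewrite sqr_sqrtr// addr_ge0// sqr_ge0.
have q0 : 0 < q by rewrite sqrtr_gt0 ltr_pwDl// sqr_ge0.
have th : test_function (fun x => gauss_test (s * x)).
  have := test_function_affine 0 s gauss_test_function.
  by under [X in test_function X -> _]funext do rewrite add0r.
rewrite (integral_test_normal 0 1 th).
transitivity (\int[mu]_x ((q^-1)%:E * (normal_pdf 0 q^-1 x)%:E))%E.
  apply: eq_integral => x _; rewrite -EFinM; congr EFin.
  rewrite !normal_pdf_expE ?invr_gt0// /gauss_test.
  rewrite mulrCA -expRD [RHS]mulrA; congr (_ * expR _).
    by field; rewrite !gt_eqF//= sqrtr_gt0 mulrn_wgt0 ?pi_gt0.
  rewrite exprVn q2 !subr0 exprMn; field.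
  by rewrite gt_eqF// ltr_pwDl// sqr_ge0.
rewrite ge0_integralZl//.
- by rewrite integral_normal_pdf mule1.
- by apply/measurable_EFinP; exact: measurable_normal_pdf.
- by move=> x _; rewrite lee_fin normal_pdf_ge0.
- by rewrite lee_fin invr_ge0 ltW.
Qed.

Lemma cvg_integral_test {d} {T : measurableType d} (nu : probability T R)
    (Z_ : nat -> T -> R) (Z : T -> R) (h : R -> R) :
  (forall n, measurable_fun setT (Z_ n)) -> measurable_fun setT Z ->
  {ae nu, forall w, Z_ n w @[n --> \oo] --> Z w} -> test_function h ->
  (\int[nu]_w (h (Z_ n w))%:E)%E @[n --> \oo] --> (\int[nu]_w (h (Z w))%:E)%E.
Proof.
move=> mZ_ mZ ZZ th.
have mh := test_measurable th.
have m1 n : measurable_fun setT (fun w => (h (Z_ n w))%:E).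
  by apply/measurable_EFinP; exact: measurableT_comp.
have m2 : measurable_fun setT (fun w => (h (Z w))%:E).
  by apply/measurable_EFinP; exact: measurableT_comp.
have a1 : {ae nu, forall w, setT w -> (h (Z_ n w))%:E @[n --> \oo] --> (h (Z w))%:E}.
  apply: filterS ZZ => w Zw _; apply: cvg_EFin; first exact: nearW.
  by apply: (cvg_comp _ _ Zw); exact: th.1.
have a2 : {ae nu, forall w n, setT w -> `|(h (Z_ n w))%:E| <= (EFin \o cst 1%R) w}%E.
  apply: aeW => w n _; rewrite /= lee_fin.
  by have /andP[h0 h1] := th.2 (Z_ n w); rewrite ger0_norm.
by have [_ _] := dominated_convergence measurableT m1 m2 a1
    (finite_measure_integrable_cst nu 1 measurableT) a2.
Qed.

(** The integrals of [gauss_test] converge to some [L], and solving L = (1 + s^2)^(-1/2) for [s]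
    shows that the [s_ n] converge; the other test functions then identify the limit law. The bound
    [c >= 0] makes [s_ n] the positive root and survives in the limit. *)
Lemma gauss_limit (Z_ : nat -> Omega -> R) (Z : Omega -> R) (s_ : nat -> R) (c : R) :
  (forall n, measurable_fun setT (Z_ n)) -> measurable_fun setT Z ->
  {ae P, forall w, Z_ n w @[n --> \oo] --> Z w} ->
  0 <= c -> (\forall n \near \oo, c <= s_ n) ->
  (forall n Y, measurable Y -> P (Z_ n @^-1` Y) = gauss_law (s_ n) Y) ->
  exists2 s, c <= s & forall Y, measurable Y -> P (Z @^-1` Y) = gauss_law s Y.
Proof.
move=> mZ_ mZ ZZ c0 cs H.
have lim h : test_function h ->
    (\int[gamma]_x (h (s_ n * x))%:E)%E @[n --> \oo] --> (\int[P]_w (h (Z w))%:E)%E.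
  move=> th; have := cvg_integral_test mZ_ mZ ZZ th.
  by under eq_fun do rewrite (integral_law (mZ_ _) th (H _)).
have := lim _ gauss_test_function.
under eq_fun do rewrite integral_gauss_test.
set I := (\int[P]_w _)%E => limI.
have mgZ : measurable_fun setT (fun w => (gauss_test (Z w))%:E).
  apply/measurable_EFinP; apply: measurableT_comp => //.
  exact: test_measurable gauss_test_function.
have I1 : (I <= 1)%E.
  apply: (@le_trans _ _ (\int[P]_w (cst 1%E w))%E); last first.
    by rewrite integral_cst//= probability_setT mule1.
  apply: ge0_le_integral => //; first by move=> w _; rewrite lee_fin expR_ge0.
  by move=> w _; rewrite lee_fin; have /andP[] := gauss_test_function.2 (Z w).
(* A limit 0 would mean deviations escaping to infinity; it is excluded because [gauss_test (Z w)]
   is positive at every [w]. *)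
have I0 : (0 < I)%E.
  rewrite lt0e integral_ge0 ?andbT; last by move=> w _; rewrite lee_fin expR_ge0.
  apply/eqP => IE.
  have : (\int[P]_w `|(gauss_test (Z w))%:E| = 0)%E.
    by rewrite -IE; apply: eq_integral => w _; rewrite gee0_abs// lee_fin expR_ge0.
  move/(ae_eq_integral_abs _ measurableT mgZ) => ae0.
  have : {ae P, forall w : Omega, False}.
    apply: filterS ae0 => w /(_ Logic.I)[] /eqP.
    by rewrite gt_eqF// expR_gt0.
  move=> -[N [mN PN sN]].
  have : (P setT <= P N)%E by apply: le_measure; rewrite ?inE// => w _; apply: sN.
  by rewrite PN probability_setT leNgt lte01.
have Ifin : I \is a fin_num by rewrite ge0_fin_numE ?ltW// (le_lt_trans I1)// ltry.
pose L := fine I.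
have L0 : 0 < L by rewrite fine_gt0// I0 (le_lt_trans I1)// ltry.
have limL : (Num.sqrt (1 + s_ n ^+ 2))^-1 @[n --> \oo] --> L.
  move: limI; by rewrite -(fineK Ifin) => /fine_cvgP[].
have lims : Num.sqrt ((Num.sqrt (1 + s_ n ^+ 2))^-1 ^- 2 - 1) @[n --> \oo] -->
    Num.sqrt (L ^- 2 - 1).
  have L2 : L ^+ 2 != 0 by rewrite expf_eq0 gt_eqF.
  have l2 : (Num.sqrt (1 + s_ n ^+ 2))^-1 ^- 2 - 1 @[n --> \oo] --> L ^- 2 - 1.
    apply: cvgB; last exact: cvg_cst.
    apply: cvgV => //.
    apply: (cvg_comp (fun n => (Num.sqrt (1 + s_ n ^+ 2))^-1) (fun x : R => x ^+ 2) limL).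
    exact: exprn_continuous.
  apply: (cvg_comp (fun n => (Num.sqrt (1 + s_ n ^+ 2))^-1 ^- 2 - 1) (@Num.sqrt R) l2).
  exact: sqrt_continuous.
have {}lims : s_ n @[n --> \oo] --> Num.sqrt (L ^- 2 - 1).
  apply: cvg_trans lims; apply: near_eq_cvg.
  apply: filterS cs => n csn.
  rewrite -exprVn invrK sqr_sqrtr ?addr_ge0 ?sqr_ge0// addrAC subrr add0r.
  by rewrite sqrtr_sqr ger0_norm// (le_trans c0).
set s := Num.sqrt (L ^- 2 - 1) in lims.
exists s; first by rewrite -(cvg_lim _ lims)//; apply: limr_ge => //; exact: cvgP lims.
apply: law_integral => // h th.
have l1 := lim h th.
have l2 : (\int[gamma]_x (h (s_ n * x))%:E)%E @[n --> \oo] --> (\int[gamma]_x (h (s *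
    x))%:E)%E.
  apply: (@cvg_integral_test _ _ gamma (fun n x => s_ n * x) (fun x => s * x)) => //.
  - by move=> n; exact: measurable_scale_fun.
  - exact: measurable_scale_fun.
  - by apply: aeW => x; apply: cvgMl.
exact: (cvg_unique _ l1 l2).
Qed.

End GaussianLimit.

(** * Wiener increments *)

Section WienerIncrements.
Context {dsp : measure_display} {Omega : measurableType dsp} {R : realType}.
Variable P : probability Omega R.
Context {m : nat}.
Variables (T : R) (B : R -> Omega -> 'cV[R]_m.+1).
Hypothesis hB : is_wiener P T B.

Lemma sum_blocks (V : nmodType) (N q : nat) (F : nat -> V) :
  \sum_(0 <= l < N * q) F l = \sum_(j < N) \sum_(i < q) F (j * q + i)%N.
Proof.
elim: N => [|N IH]; first by rewrite mul0n big_geq// big_ord0.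
rewrite big_ord_recr /= -IH mulSn addnC (@big_cat_nat _ _ _ (N * q)) ?leq_addr//=.
congr (_ + _); rewrite -{1}[(N * q)%N]add0n big_addn addKn big_mkord.
by apply: eq_bigr => i _; rewrite addnC.
Qed.

Lemma measurable_increment (s t : R) (i : 'I_m.+1) : 0 <= s -> s <= t -> t < T ->
  measurable_fun setT (fun w => (B t w - B s w) i ord0).
Proof.
move=> s0 st tT.
have mBi u : 0 <= u < T -> measurable_fun setT (fun w => B u w i ord0).
  by move=> uT _ Y mY; rewrite setTI; exact: (wiener_measurable hB uT).
rewrite (_ : (fun w => _) = (fun w => B t w i ord0 - B s w i ord0)); last first.
  by apply/funext => w; rewrite !mxE.
by apply: measurable_funB; apply: mBi; rewrite ?s0 ?(le_trans s0) ?(le_lt_trans st).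
Qed.

Let gen (u : R) := [set E | exists (s : R) (i : 'I_m.+1) (Y : set R),
  [/\ 0 <= s <= u, measurable Y & E = (fun w => B s w i ord0) @^-1` Y]].

(** Measurability of a difference, applied on the sample space equipped with the sigma-algebra
    generated up to time [u]. *)
Lemma increment_canonical (s t u : R) (i : 'I_m.+1) (Y : set R) :
  0 <= s -> s <= t -> t <= u -> measurable Y ->
  canonical_filtration B u ((fun w => (B t w - B s w) i ord0) @^-1` Y).
Proof.
move=> s0 st tu mY.
have mB v : 0 <= v <= u ->
    measurable_fun [set: g_sigma_algebraType (gen u)] (fun w : g_sigma_algebraType
        (gen u) => B v w i ord0).
  move=> vu _ Z mZ; rewrite setTI; apply: sub_sigma_algebra.
  by exists v, i, Z.
have mD : measurable_fun [set: g_sigma_algebraType (gen u)]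
    (fun w : g_sigma_algebraType (gen u) => B t w i ord0 - B s w i ord0).
  by apply: measurable_funB; apply: mB; rewrite ?s0 ?(le_trans s0)//= (le_trans st).
rewrite (_ : (fun w => _) = (fun w => B t w i ord0 - B s w i ord0)); last first.
  by apply/funext => w; rewrite !mxE.
by have := mD measurableT Y mY; rewrite setTI.
Qed.

Variables (t : R) (n : nat).
Hypotheses (t0 : 0 < t) (tT : t < T).

Let g (j : nat) : R := t * (j%:R / n.+1%:R).

Let g_ge0 j : 0 <= g j.
Proof. by rewrite mulr_ge0 ?divr_ge0// ltW. Qed.

Let gS j : g j.+1 - g j = t / n.+1%:R.
Proof. by rewrite /g -mulrBr -mulrBl -natrB// subSnn mul1r. Qed.

Let g_lt j : g j < g j.+1.
Proof. by rewrite -subr_gt0 gS divr_gt0. Qed.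

Let g_le j k : (j <= k)%N -> g j <= g k.
Proof.
by move=> jk; rewrite ler_wpM2l ?(ltW t0)// ler_wpM2r ?invr_ge0// ler_nat.
Qed.

Let g_ltT j : (j <= n.+1)%N -> g j < T.
Proof.
move=> jn; apply: le_lt_trans tT; rewrite ler_piMr ?(ltW t0)//.
by rewrite ler_pdivrMr ?ltr0n// mul1r ler_nat.
Qed.

(* The scalar increments are enumerated by [l = j * m.+1 + i], for the time
   step [j] and the coordinate [i]; steps beyond the grid are set to [0]. *)
Let W (l : nat) (w : Omega) : R :=
  if (l %/ m.+1 < n.+1)%N then
    (B (g (l %/ m.+1).+1) w - B (g (l %/ m.+1)) w) (inord (l %% m.+1)) ord0
  else 0.

Let W_idx j (i : 'I_m.+1) w : (j < n.+1)%N ->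
  W (j * m.+1 + i) w = (B (g j.+1) w - B (g j) w) i ord0.
Proof.
move=> jn; rewrite /W divnMDl// divn_small// addn0 jn modnMDl modn_small//.
by rewrite inord_val.
Qed.

Let mW l : measurable_fun setT (W l).
Proof.
have [ln|ln] := boolP (l %/ m.+1 < n.+1)%N; last first.
  rewrite (_ : W l = cst 0); first exact: measurable_cst.
  by apply/funext => w; rewrite /W (negbTE ln).
rewrite (_ : W l = fun w => (B (g (l %/ m.+1).+1) w - B (g (l %/ m.+1)) w)
    (inord (l %% m.+1)) ord0); last by apply/funext => w; rewrite /W ln.
by apply: measurable_increment => //; [exact: ltW|exact: g_ltT].
Qed.

Let sg := Num.sqrt (t / n.+1%:R).

(** Induction over time steps: the event [F j] on the first [j] steps belongs to the canonical
    filtration at [g j], so it is independent of the next increment, whose [m.+1] coordinates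
    contribute the next block of factors. *)
Lemma grid_increments_law (Y : nat -> set R) : (forall l, measurable (Y l)) ->
  P [set w | forall l, (l < n.+1 * m.+1)%N -> Y l (W l w)] =
  (\prod_(0 <= l < n.+1 * m.+1) gauss_law sg (Y l))%E.
Proof.
move=> mY.
pose F j := [set w | forall l, (l < j * m.+1)%N -> Y l (W l w)].
have FS j : (j < n.+1)%N ->
    F j.+1 = F j `&` increment_event B (g j) (g j.+1) (fun i => Y (j * m.+1 + i)%N).
  move=> jn; apply/seteqP; split => w /=.
    move=> h; split=> [l lj|i]; first by apply: h; rewrite (leq_trans lj)// leq_mul2r
        leqnSn orbT.
    by rewrite -(W_idx i w jn); apply: h; rewrite mulSn addnC ltn_add2r.
  move=> [h1 h2] l lj.
  have [l1|l1] := ltnP l (j * m.+1); first exact: h1.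
  have li : (l - j * m.+1 < m.+1)%N by rewrite ltn_subLR// addnC -mulSn.
  by have := h2 (Ordinal li); rewrite -(W_idx (Ordinal li) w jn) /= subnKC.
have FC j : (j <= n.+1)%N -> canonical_filtration B (g j) (F j).
  move=> jn.
  pose H l : set Omega := if (l < j * m.+1)%N then W l @^-1` Y l else setT.
  rewrite (_ : F j = \bigcap_l H l); last first.
    apply/seteqP; split => w /= h l.
      by move=> _; rewrite /H; case: ifP => // /h.
    by move=> lj; have := h l Logic.I; rewrite /H lj.
  apply: (@bigcapT_measurable _ (g_sigma_algebraType (gen (g j))) H) => l.
  rewrite /H; case: ifP => [lj|_]; last exact: measurableT.
  have lj' : (l %/ m.+1 < j)%N by rewrite ltn_divLR.
  rewrite (_ : W l = fun w => (B (g (l %/ m.+1).+1) w - B (g (l %/ m.+1)) w)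
    (inord (l %% m.+1)) ord0); last by apply/funext => w; rewrite /W (leq_trans lj' jn).
  apply: increment_canonical => //; [exact: ltW|exact: g_le].
suff : forall j, (j <= n.+1)%N -> P (F j) = (\prod_(0 <= l < j * m.+1) gauss_law sg
    (Y l))%E.
  by apply.
elim => [_|j IH jn].
  rewrite mul0n big_geq// -(probability_setT P); congr (P _).
  by apply/seteqP; split => w.
rewrite FS// (wiener_independent hB)//; last first.
- exact: FC (ltnW jn).
- exact: g_ltT.
have PI : P (increment_event B (g j) (g j.+1) (fun i => Y (j * m.+1 + i)%N)) =
    (\prod_(i < m.+1) gauss_law sg (Y (j * m.+1 + i)%N))%E.
  rewrite (wiener_increment hB (g_ge0 j) (g_lt j) (g_ltT jn) (fun i => mY _)) gS.
  apply: eq_bigr => i _; apply/esym/gauss_law_normal; last exact: mY.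
  by rewrite sqrtr_gt0 divr_gt0.
rewrite (IH (ltnW jn)) PI [in RHS]mulSn [in RHS]addnC.
rewrite [RHS](@big_cat_nat _ _ _ (j * m.+1)) ?leq_addr//.
congr (_ * _)%E; rewrite -{2}[(j * m.+1)%N]add0n big_addn addKn big_mkord.
by apply: eq_bigr => i _; rewrite addnC.
Qed.

Lemma grid_combination_law (a : nat -> 'rV[R]_m.+1) (Y : set R) : measurable Y ->
  P ((fun w => \sum_(j < n.+1) (a j *m (B (g j.+1) w - B (g j) w)) ord0 ord0) @^-1` Y) =
  gauss_law (Num.sqrt (\sum_(j < n.+1) \sum_i (a j ord0 i) ^+ 2 * (t / n.+1%:R))) Y.
Proof.
move=> mY.
pose c l := a (l %/ m.+1)%N ord0 (inord (l %% m.+1)).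
have cE j (i : 'I_m.+1) : c (j * m.+1 + i)%N = a j ord0 i.
  rewrite /c divnMDl// divn_small// addn0 modnMDl modn_small//.
  by rewrite inord_val.
have := gauss_sum c mW grid_increments_law mY.
rewrite sum_blocks => H.
rewrite (_ : (fun w => _) = (fun w => \sum_(0 <= l < n.+1 * m.+1) c l * W l w)); last
    first.
  apply/funext => w; rewrite sum_blocks; apply: eq_bigr => j _; rewrite mxE.
  by apply: eq_bigr => i _; rewrite cE W_idx.
rewrite H; congr (gauss_law (Num.sqrt _) Y).
apply: eq_bigr => j _; apply: eq_bigr => i _.
by rewrite cE exprMn sqr_sqrtr// divr_ge0// ltW.
Qed.

Lemma measurable_grid_combination (a : nat -> 'rV[R]_m.+1) :
  measurable_fun setT
   (fun w => \sum_(j < n.+1) (a j *m (B (g j.+1) w - B (g j) w)) ord0 ord0).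
Proof.
apply: measurable_sum => j.
under eq_fun do rewrite mxE.
apply: measurable_sum => i; apply: measurable_funM => //.
by apply: measurable_increment => //; [exact: ltW|exact: g_ltT].
Qed.

End WienerIncrements.

(** * Endpoint limit of the solution *)

Section Pathwise.
Context {R : realType}.

Lemma within_itv_continuous_at (g : R -> R) (T t : R) :
  {within `[0, T[, continuous g} -> 0 < t < T -> {for t, continuous g}.
Proof.
move=> cg t0T.
have : {within `]0, T[, continuous g}.
  apply: continuous_subspaceW cg => x /=; rewrite !in_itv/= => /andP[x0 ->].
  by rewrite ltW.
rewrite continuous_open_subspace; last exact: interval_open.
by apply; rewrite inE /= in_itv.
Qed.

Lemma within_entry {m n : nat} (D : set R) (F : R -> 'M[R]_(m, n)) i j :
  {within D, continuous F} -> {within D, continuous (fun t => F t i j)}.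
Proof.
move=> cF; apply/subspace_continuousP => x Dx.
by have /subspace_continuousP/(_ x Dx)/cvg_mxP := cF; apply.
Qed.

(** Near [t] the difference [X - W] is the integral of a continuous drift, so the fundamental
    theorem of calculus applies; the midpoint [u] supplies a closed interval inside [0, T[ with [t]
    in its interior. *)
Lemma solution_drift {d : nat} (A : 'M[R]_d) (T : R) (X W : R -> 'cV[R]_d) :
  (forall i, {within `[0, T[, continuous (fun s => X s i ord0)}) ->
  (forall t, 0 <= t < T -> X t =
      \col_(i < d) (\int[lebesgue_measure]_(s in `[0, t])
        ((- ((T - s)^-1 *: (A *m X s))) i ord0)) + W t) ->
  forall t, 0 < t < T ->
    mx_is_derive t (fun s => X s - W s) (- (T - t)^-1 *: (A *m X t)).
Proof.
move=> cX XE t /andP[t0 tT] i j; rewrite ord1 {j}.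
pose k s := (- ((T - s)^-1 *: (A *m X s))) i ord0.
have ck : {within `[0, T[, continuous k}.
  have -> : k = fun s => - ((T - s)^-1 * \sum_l A i l * X s l ord0).
    by apply/funext => s; rewrite /k !mxE.
  apply/subspace_continuousP => x; rewrite /= in_itv/= => /andP[x0 xT].
  apply: cvgN; apply: cvgM.
    apply: cvgV; first by rewrite gt_eqF// subr_gt0.
    by apply: cvgB; [exact: cvg_cst|exact: cvg_within].
  apply: cvg_sumr => l; apply: cvgMr.
  by have /subspace_continuousP := cX l; apply; rewrite /= in_itv/= x0.
pose u := (t + T) / 2.
have tu : t < u by rewrite midf_lt.
have uT : u < T by rewrite midf_lt.
have intk : (@lebesgue_measure R).-integrable `[0, u] (EFin \o k).
  apply: continuous_compact_integrable; first exact: segment_compact.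
  apply: continuous_subspaceW ck => x /=; rewrite !in_itv/= => /andP[-> /=] xu.
  exact: le_lt_trans uT.
have ckt : {for t, continuous k}.
  by apply: (within_itv_continuous_at ck); rewrite t0.
have [dF F'] := continuous_FTC1_closed tu intk t0 ckt.
have dI : is_derive t 1 (fun s => \int[lebesgue_measure]_(r in `[0, s]) k r) (k t).
  by apply: (DeriveDef dF); rewrite -derive1E; exact: F'.
rewrite (_ : _ i ord0 = k t); last by rewrite /k scaleNr.
apply: near_eq_is_derive dI; near=> s.
have s0T : 0 <= s < T.
  have : s \in `]0, T[ by near: s; apply: near_in_itvoo; rewrite in_itv/= t0.
  by rewrite in_itv/= => /andP[/ltW -> ->].
by rewrite (XE s s0T) addrK mxE.
Unshelve. all: by end_near. Qed.

Lemma cvg_mulmx {U : Type} {F : set_system U} {FF : Filter F} {m n p : nat}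
    (f : U -> 'M[R]_(m, n)) (g : U -> 'M[R]_(n, p))
    (a : 'M[R]_(m, n)) (b : 'M[R]_(n, p)) :
  f x @[x --> F] --> a -> g x @[x --> F] --> b ->
  f x *m g x @[x --> F] --> a *m b.
Proof.
move=> /cvg_mxP fa /cvg_mxP gb; apply/cvg_mxP => i j; rewrite mxE.
under eq_fun do rewrite mxE.
by apply: cvg_sumr => k; apply: cvgM.
Qed.

Lemma cvg_mulmxl {U : Type} {F : set_system U} {FF : Filter F} {m n p : nat}
    (c : 'M[R]_(m, n)) (g : U -> 'M[R]_(n, p)) (b : 'M[R]_(n, p)) :
  g x @[x --> F] --> b -> c *m g x @[x --> F] --> c *m b.
Proof. by move=> gb; apply: cvg_mulmx => //; exact: cvg_cst. Qed.

Lemma cvg_mx_entry {U : Type} {F : set_system U} {FF : Filter F} {m n : nat}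
    (f : U -> 'M[R]_(m, n)) (a : 'M[R]_(m, n)) i j :
  f x @[x --> F] --> a -> f x i j @[x --> F] --> a i j.
Proof. by move=> /cvg_mxP. Qed.

Lemma normr_entry_le_enorm {d : nat} (v : 'cV[R]_d) i : `|v i ord0| <= enorm v.
Proof.
rewrite -sqrtr_sqr /enorm ler_sqrt; last by apply: sumr_ge0 => k _; exact: sqr_ge0.
by rewrite (bigD1 i)//= lerDl; apply: sumr_ge0 => k _; exact: sqr_ge0.
Qed.

(** A coordinate of [f g] is at most a row sum of absolute entries of [f] times the norm of [g]. It
    stays away from 0 while the row sum vanishes, so the norm must blow up. *)
Lemma cvg_enorm_pinfty {U : Type} {F : set_system U} {FF : Filter F} {d : nat}
    (f : U -> 'M[R]_d) (g : U -> 'cV[R]_d) (v : 'cV[R]_d) :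
  f x @[x --> F] --> (0 : 'M[R]_d) -> f x *m g x @[x --> F] --> v -> v != 0 ->
  enorm (g x) @[x --> F] --> +oo.
Proof.
move=> /cvg_mxP f0 /cvg_mxP fgv v0.
have [i vi] : exists i, v i ord0 != 0.
  apply: contrapT => H; move/eqP: v0; apply; apply/matrixP => i j.
  by rewrite ord1 mxE; apply/eqP; apply: contrapT => /negP h; apply: H; exists i.
have vi0 : 0 < `|v i ord0| by rewrite normr_gt0.
have fsum : \sum_k `|f x i k| @[x --> F] --> \sum_k `|(0 : 'M[R]_d) i k|.
  by apply: cvg_sumr => k; exact: (cvg_norm (f0 i k)).
rewrite [X in _ --> X]big1 in fsum; last by move=> k _; rewrite mxE normr0.
apply/cvgryPge => K.
pose K1 := `|K| + 1; have K10 : 0 < K1 by rewrite ltr_wpDl.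
have e0 : 0 < `|v i ord0| / (2 * K1) by rewrite divr_gt0// mulr_gt0.
have e1 : 0 < `|v i ord0| / 2 by rewrite divr_gt0.
have /cvgrPdist_lt/(_ _ e0) h0 := fsum.
have /cvgrPdist_lt/(_ _ e1) h1 := fgv i ord0.
near=> x.
have x0 : \sum_k `|f x i k| < `|v i ord0| / (2 * K1).
  have := near h0 x; rewrite sub0r normrN => h.
  by apply: (le_lt_trans (ler_norm _)); apply: h.
have x1 : `|v i ord0| / 2 < `|(f x *m g x) i ord0|.
  have h : `|v i ord0 - (f x *m g x) i ord0| < `|v i ord0| / 2 by near: x.
  have := ler_normD (v i ord0 - (f x *m g x) i ord0) ((f x *m g x) i ord0).
  by rewrite subrK; lra.
have x2 : `|(f x *m g x) i ord0| <= (\sum_k `|f x i k|) * enorm (g x).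
  rewrite mxE (le_trans (ler_norm_sum _ _ _))// mulr_suml; apply: ler_sum => k _.
  by rewrite normrM ler_wpM2l// normr_entry_le_enorm.
have g0 : 0 <= enorm (g x) by exact: sqrtr_ge0.
have x3 : `|v i ord0| / 2 < `|v i ord0| / (2 * K1) * enorm (g x).
  apply: (lt_le_trans x1); apply: (le_trans x2); rewrite ler_wpM2r//; exact: ltW.
have : K1 < enorm (g x).
  move: x3; rewrite (_ : _ / (2 * K1) * _ = (`|v i ord0| / 2) * (enorm (g x) / K1));
      last first.
    by field; rewrite gt_eqF.
  by rewrite ltr_pMr// ltr_pdivlMr// mul1r.
by move=> /ltW; apply: le_trans; rewrite (le_trans (ler_norm K))// lerDl.
Unshelve. all: by end_near. Qed.

End Pathwise.

(** * The solution process: convergence, law and nonvanishing of the endpoint *)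

Section Solution.
Context {R : realType} {dsp : measure_display} {Omega : measurableType dsp}.
Variable P : probability Omega R.
Context {d m : nat}.
Variables (T : R) (A : 'M[R]_d.+1) (Sigma : 'M[R]_(d.+1, m.+1)).
Variables (B : R -> Omega -> 'cV[R]_m.+1) (X : R -> Omega -> 'cV[R]_d.+1).
Hypotheses (T0 : 0 < T) (hB : is_wiener P T B).
Hypothesis hF : is_filtration T (completed_filtration P B).
Hypothesis hX : is_strong_solution P T A Sigma B X.
Hypothesis hA : ReSpec A `<=` `]0, 1 / 2[.

Let f (t : R) := mxpowR (T - t) (- A).

(* The completed filtration is assumed to lie in the sigma-algebra of [P]. *)
Lemma negligible_measurable (N : set Omega) : P.-negligible N -> measurable N.
Proof.
move=> nN; apply: (filtration_sub hF (t := 0)); first by rewrite lexx.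
by apply: sub_sigma_algebra; right.
Qed.

Lemma ae_measurable (Q : Omega -> Prop) : {ae P, forall w, Q w} -> measurable [set w
    | Q w].
Proof.
by move=> aeQ; rewrite -(setCK [set w | Q w]); apply: measurableC; exact:
    negligible_measurable.
Qed.

Lemma measurable_solution (t : R) i : 0 <= t < T ->
  measurable_fun setT (fun w => X t w i ord0).
Proof.
move=> tT _ Y mY; rewrite setTI.
by apply: (filtration_sub hF tT); exact: (solution_adapted hX tT).
Qed.

Lemma measurable_wiener (t : R) i : 0 <= t < T ->
  measurable_fun setT (fun w => B t w i ord0).
Proof. by move=> tT _ Y mY; rewrite setTI; exact: (wiener_measurable hB tT). Qed.

(** Taking [setT] for the other coordinates reduces the product formula for increments to a single
    factor. *)
Lemma wiener_tail (s t lam : R) (i : 'I_m.+1) : 0 <= s -> s < t -> t < T -> 0 <= lam ->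
  (P [set w | (lam < `|B t w i ord0 - B s w i ord0|)%R] <=
   normal_prob 0 (Num.sqrt (t - s)) [set x : R | (lam < `|x|)%R])%E.
Proof.
move=> s0 st tT lam0.
pose Y (k : 'I_m.+1) : set R := if k == i then [set x : R | lam < `|x|] else setT.
have mY k : measurable (Y k).
  rewrite /Y; case: eqP => // _.
  rewrite [X in measurable X](_ : _ = (@Num.norm _ R) @^-1` `]lam, +oo[); last first.
    by apply/seteqP; split => x /=; rewrite in_itv/= andbT.
  by rewrite -[X in measurable X]setTI; exact: normr_measurable.
have := wiener_increment hB s0 st tT mY.
rewrite (bigD1 i)//= big1 ?mule1; last first.
  move=> k ki; rewrite /Y (negbTE ki).
  exact: (probability_setT (normal_prob 0 (Num.sqrt (t - s)))).
rewrite {2}/Y eqxx => <-; apply: le_measure; rewrite ?inE.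
- have mD : measurable_fun setT (fun w => `|B t w i ord0 - B s w i ord0|).
    apply: measurableT_comp => //; apply: measurable_funB; apply: measurable_wiener.
      by rewrite tT (le_trans s0)// ltW.
    by rewrite s0 (lt_trans st).
  rewrite [X in measurable X](_ : _ = (fun w => `|B t w i ord0 - B s w i ord0|) @^-1`
      `]lam, +oo[); last first.
    by apply/seteqP; split => x /=; rewrite in_itv/= andbT.
  by rewrite -[X in measurable X]setTI; exact: mD.
- rewrite (_ : increment_event B s t Y = \bigcap_(k : 'I_m.+1) ((fun w => (B t w - B
    s w) k ord0) @^-1` Y k)); last first.
    by apply/seteqP; split => w /= h k; [move=> _; exact: h|exact: h].
  apply: fin_bigcap_measurable => // k _.
  rewrite -[X in measurable X]setTI; apply: (measurable_increment hB) => //; exact: ltW.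
- move=> w /= lw k; rewrite /Y; case: eqP => [->|//].
  by rewrite /= !mxE.
Qed.

Lemma wiener_holder (be : R) : 0 < be < 1 / 2 ->
  {ae P, forall w, exists (b : 'cV[R]_m.+1) (C : R),
    \forall t \near T^'-, forall i, `|(B t w - b) i ord0| <= C * (T - t) `^ be}.
Proof.
move=> be01.
have H i : {ae P, forall w, exists (l C : R) (K : nat), forall t,
    T - T / 2 ^+ K <= t < T -> `|B t w i ord0 - l| <= C * (T - t) `^ be}.
  apply: (holder_at_endpoint T0 be01).
  - by move=> t tT; exact: measurable_wiener.
  - by move=> s t lam s0 st tT lam0; exact: wiener_tail.
  - by apply: filterS (wiener_continuous hB) => w cB; exact: within_entry.
have : {ae P, forall w, forall i, exists (l C : R) (K : nat), forall t,
    T - T / 2 ^+ K <= t < T -> `|B t w i ord0 - l| <= C * (T - t) `^ be}.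
  exact: filter_forall.
apply: filterS => w hw.
have [l hl] := choice hw; have [C hC] := choice hl.
exists (\col_i l i), (\sum_i `|C i|).
apply: filter_forall => i; have [K hK] := hC i.
have TK : T - T / 2 ^+ K < T by rewrite ltrBlDr ltrDl divr_gt0// exprn_gt0.
near=> t; rewrite !mxE.
have tK : T - T / 2 ^+ K <= t < T.
  by apply/andP; split; near: t; [exact: nbhs_left_ge|exact: nbhs_left_lt].
apply: (le_trans (hK t tK)); apply: ler_wpM2r; first exact: powR_ge0.
by rewrite (bigD1 i)//= (le_trans (ler_norm _))// lerDl sumr_ge0.
Unshelve. all: by end_near. Qed.

(** What the deterministic lemmas require of a path, gathered into one condition that holds almost
    surely. *)
Definition regular_path (w : Omega) :=
  [/\ forall i, {within `[0, T[, continuous (fun t => X t w i ord0)},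
      forall i, {within `[0, T[, continuous (fun t => (Sigma *m B t w) i ord0)},
      X 0 w = 0 &
      forall t, 0 < t < T -> mx_is_derive t (fun s => X s w - Sigma *m B s w)
        (- (T - t)^-1 *: (A *m X t w))].

Lemma ae_regular_path : {ae P, forall w, regular_path w}.
Proof.
have H1 : {ae P, forall w, {within `[0, T[, continuous (fun t => X t w)} /\
    {within `[0, T[, continuous (fun t => B t w)}}.
  by apply: filterS2 (solution_continuous hX) (wiener_continuous hB).
have H2 : {ae P, forall w, X 0 w = 0 /\ forall t, 0 <= t < T -> X t w =
      \col_(i < d.+1) (\int[lebesgue_measure]_(s in `[0, t])
        ((- ((T - s)^-1 *: (A *m X s w))) i ord0)) + Sigma *m B t w}.
  by apply: filterS2 (solution_start hX) (solution_equation hX).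
apply: filterS2 H1 H2 => w [cX cB] [X0 XE]; split => //.
- by move=> i; exact: within_entry.
- move=> i.
  have -> : (fun t => (Sigma *m B t w) i ord0) = fun t => \sum_k Sigma i k * B t w k ord0.
    by apply/funext => t; rewrite mxE.
  apply/subspace_continuousP => t t0T; apply: cvg_sumr => k; apply: cvgMr.
  by have /subspace_continuousP := within_entry (i := k) (j := ord0) cB; apply.
- apply: (solution_drift (W := fun t => Sigma *m B t w)) => // i.
  exact: within_entry.
Qed.

Lemma ae_cvg_solution :
  {ae P, forall w, cvg (mxpowR (T - t) (- A) *m X t w @[t --> T^'-])}.
Proof.
have hA' : ReSpec A `<=` `]-oo, 1 / 2[.
  by move=> x /hA /=; rewrite !in_itv/= => /andP[].
have [a a2 [C1 C10 fC]] := mxpow_growth hA'.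
(* Any exponent strictly between [max a 0] and 1/2 serves: above [a] for the convergence, positive
   and below 1/2 for the Hoelder bound. *)
pose be := (Num.max a 0 + 1 / 2) / 2.
have m2 : Num.max a 0 < 1 / 2 by rewrite gt_max a2 divr_gt0.
have be2 : be < 1 / 2 by rewrite midf_lt.
have mbe : Num.max a 0 < be by rewrite midf_lt.
have abe : a < be by apply: le_lt_trans mbe; rewrite le_max lexx.
have be0 : 0 < be by apply: le_lt_trans mbe; rewrite le_max lexx orbT.
have be01 : 0 < be < 1 / 2 by rewrite be0.
apply: filterS2 ae_regular_path (wiener_holder be01) => w [cX cW X0 dZ] [b [C hC]].
have [eta /= eta0 heta] := hC.
(* Capping at [T] keeps the times positive, where [regular_path] gives the derivative. *)
pose e := Num.min eta T.
have e0 : 0 < e by rewrite lt_min eta0.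
apply: (solution_endpoint_cvg (W := fun t => Sigma *m B t w) (w := Sigma *m b)
  (C := (\sum_i \sum_k `|Sigma i k|) * C) fC abe e0).
- move=> t /andP[t1 tT]; apply: dZ; rewrite tT andbT.
  by rewrite (le_lt_trans _ t1)// subr_ge0 ge_min lexx orbT.
- move=> t i /andP[t1 tT].
  have ht k : `|(B t w - b) k ord0| <= C * (T - t) `^ be.
    apply: heta => //=; rewrite gtr0_norm ?subr_gt0// ltrBlDr -ltrBlDl.
    by apply: le_lt_trans t1; rewrite lerD2l lerN2 ge_min lexx.
  have Cp : 0 <= C * (T - t) `^ be := le_trans (normr_ge0 _) (ht ord0).
  rewrite -mulmxBr mxE (le_trans (ler_norm_sum _ _ _))//.
  rewrite -mulrA (bigD1 i)//= mulrDl -[leLHS]addr0 lerD//.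
    by rewrite mulr_suml; apply: ler_sum => k _; rewrite normrM ler_wpM2l.
  by rewrite mulr_ge0//; apply: sumr_ge0 => k _; apply: sumr_ge0.
Qed.

Let grid (t : R) (n j : nat) : R := t * (j%:R / n.+1%:R).

Lemma ae_riemann (t : R) : 0 <= t < T ->
  {ae P, forall w, \sum_(j < n.+1) f (grid t n j) *m
     (Sigma *m B (grid t n j.+1) w - Sigma *m B (grid t n j) w) @[n --> \oo]
   --> f t *m X t w}.
Proof.
move=> tT; apply: filterS ae_regular_path => w [cX cW X0 dZ].
exact: (solution_riemann (W := fun t => Sigma *m B t w) tT cX cW dZ X0).
Qed.

(** Standard deviation of [u^T] applied to the Riemann sum of [f Sigma dB] over [0, t] with [n.+1]
    cells. *)
Let sd (u : 'cV[R]_d.+1) (t : R) (n : nat) : R :=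
  Num.sqrt (\sum_(j < n.+1) \sum_i
    ((u^T *m f (grid t n j) *m Sigma) ord0 i) ^+ 2 * (t / n.+1%:R)).

Lemma measurable_functional (Z : Omega -> 'cV[R]_d.+1) (u : 'cV[R]_d.+1) :
  (forall i, measurable_fun setT (fun w => Z w i ord0)) ->
  measurable_fun setT (fun w => (u^T *m Z w) ord0 ord0).
Proof.
move=> mZ; under eq_fun do rewrite mxE.
by apply: measurable_sum => i; apply: measurable_funM.
Qed.

Lemma measurable_scaled_solution (t : R) i : 0 <= t < T ->
  measurable_fun setT (fun w => (f t *m X t w) i ord0).
Proof.
move=> tT; under eq_fun do rewrite mxE.
apply: measurable_sum => k; apply: measurable_funM => //.
exact: measurable_solution.
Qed.

Lemma law_fixed_time (u : 'cV[R]_d.+1) (c t : R) : 0 < t < T -> 0 <= c ->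
  (forall n, c <= sd u t n) ->
  exists2 s, c <= s & forall Y, measurable Y ->
    P ((fun w => (u^T *m (f t *m X t w)) ord0 ord0) @^-1` Y) = gauss_law s Y.
Proof.
move=> /andP[t0 tT] c0 csd.
have t0T : 0 <= t < T by rewrite tT ltW.
pose a n j := u^T *m f (grid t n j) *m Sigma.
pose S n w := \sum_(j < n.+1) (a n j *m (B (grid t n j.+1) w - B (grid t n j) w))
    ord0 ord0.
have mS n : measurable_fun setT (S n).
  exact: (measurable_grid_combination hB n t0 tT (a n)).
have mZ : measurable_fun setT (fun w => (u^T *m (f t *m X t w)) ord0 ord0).
  by apply: measurable_functional => i; exact: measurable_scaled_solution.
apply: (@gauss_limit _ _ _ P S _ (sd u t) c mS mZ _ c0).
- apply: filterS (ae_riemann t0T) => w hw.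
  have h : (u^T *m \sum_(j < n.+1) f (grid t n j) *m
      (Sigma *m B (grid t n j.+1) w - Sigma *m B (grid t n j) w)) ord0 ord0
      @[n --> \oo] --> (u^T *m (f t *m X t w)) ord0 ord0.
    by apply: cvg_mx_entry; exact: cvg_mulmxl.
  move: h; apply: cvg_trans; apply: near_eq_cvg; apply: nearW => n.
  rewrite mulmx_sumr summxE; apply: eq_bigr => j _.
  by rewrite /a -mulmxBr !mulmxA.
- exact: nearW.
- by move=> n Y mY; exact: (grid_combination_law hB n t0 tT (a n) mY).
Qed.

(** The shift by 2 makes [tk 0 = T / 2] positive. *)
Let tk (k : nat) : R := T - T / k.+2%:R.

Lemma tk_itv k : 0 < tk k < T.
Proof.
rewrite /tk subr_gt0 ltrBlDr ltrDl divr_gt0// andbT.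
by rewrite ltr_pdivrMr// ltr_pMr// ltr1n.
Qed.

Lemma cvg_tk_left : tk k @[k --> \oo] --> T^'-.
Proof.
move=> S [e /= e0 hS].
have /cvgrPdist_lt/(_ e e0)[N _ hN] : T * @harmonic R k @[k --> \oo] --> T * 0.
  by apply: cvgMr; exact: cvg_harmonic.
exists N => // k /= Nk; apply: hS => /=; last by have /andP[] := tk_itv k.
have := hN k.+1 (leq_trans Nk (leqnSn k)).
by rewrite mulr0 sub0r normrN /harmonic /tk opprB addrC subrK.
Qed.

Let good := [set w | cvg (f t *m X t w @[t --> T^'-])].

(** The default 0 off [good] gives a vector defined everywhere; [good] is measurable, being the
    complement of a negligible set, so the result is a random vector. *)
Definition endpoint (w : Omega) : 'cV[R]_d.+1 :=
  if `[< good w >] then lim (f t *m X t w @[t --> T^'-]) else 0.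

Lemma good_cvg_endpoint w : good w -> f t *m X t w @[t --> T^'-] --> endpoint w.
Proof. by move=> gw; rewrite /endpoint asboolT. Qed.

Lemma ae_cvg_endpoint :
  {ae P, forall w, mxpowR (T - t) (- A) *m X t w @[t --> T^'-] --> endpoint w}.
Proof. by apply: filterS ae_cvg_solution => w /good_cvg_endpoint. Qed.

Lemma measurable_endpoint i : measurable_fun setT (fun w => endpoint w i ord0).
Proof.
have mgood : measurable good by apply: ae_measurable; exact: ae_cvg_solution.
(* The indicator of [good] makes the convergence hold at every [w], not only almost surely. *)
apply: (measurable_fun_cvg (h := fun k w => (f (tk k) *m X (tk k) w) i ord0 * \1_good w)).
  move=> k; apply: measurable_funM; last exact: measurable_indic.
  by apply: measurable_scaled_solution; have /andP[/ltW -> ->] := tk_itv k.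
move=> w _; have [gw|gw] := pselect (good w).
  rewrite indicE mem_set//.
  have h : (f t *m X t w) i ord0 @[t --> T^'-] --> endpoint w i ord0.
    exact: cvg_mx_entry (good_cvg_endpoint gw).
  under eq_fun do rewrite mulr1.
  exact: (cvg_comp _ _ cvg_tk_left h).
rewrite indicE memNset// /endpoint asboolF// mxE.
under eq_fun do rewrite mulr0.
exact: cvg_cst.
Qed.

(** Passage from fixed times to [T] along [tk]. The lower bound is asked only from [dl] on, which
    suffices since [tk] eventually exceeds [dl]; earlier times use the bound 0. *)
Lemma law_endpoint (u : 'cV[R]_d.+1) (c dl : R) : 0 <= c -> dl < T ->
  (forall t n, dl <= t < T -> c <= sd u t n) ->
  exists2 s, c <= s & forall Y, measurable Y ->
    P ((fun w => (u^T *m endpoint w) ord0 ord0) @^-1` Y) = gauss_law s Y.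
Proof.
move=> c0 dlT csd.
have /choice[s hs] k : exists s, (dl <= tk k -> c <= s) /\ forall Y, measurable Y ->
    P ((fun w => (u^T *m (f (tk k) *m X (tk k) w)) ord0 ord0) @^-1` Y) = gauss_law s Y.
  have [dk|dk] := boolP (dl <= tk k).
    have [|s cs hs] := @law_fixed_time u c (tk k) (tk_itv k) c0.
      by move=> n; apply: csd; rewrite dk; have /andP[] := tk_itv k.
    by exists s.
  have [|s cs hs] := @law_fixed_time u 0 (tk k) (tk_itv k) (lexx _).
    by move=> n; exact: sqrtr_ge0.
  by exists s; split.
apply: (@gauss_limit _ _ _ P (fun k w => (u^T *m (f (tk k) *m X (tk k) w)) ord0 ord0)
    _ s c).
- move=> k; apply: measurable_functional => i; apply: measurable_scaled_solution.
  by have /andP[/ltW -> ->] := tk_itv k.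
- by apply: measurable_functional => i; exact: measurable_endpoint.
- apply: filterS ae_cvg_endpoint => w hw.
  have hk : f (tk k) *m X (tk k) w @[k --> \oo] --> endpoint w.
    exact: (cvg_comp _ _ cvg_tk_left hw).
  have h : (u^T *m (f (tk k) *m X (tk k) w)) ord0 ord0 @[k --> \oo]
      --> (u^T *m endpoint w) ord0 ord0.
    apply: (cvg_mx_entry (f := fun k => u^T *m (f (tk k) *m X (tk k) w))).
    exact: (cvg_mulmxl (c := u^T) hk).
  exact: h.
- exact: c0.
- have : \forall k \near \oo, dl <= tk k.
    exact: (cvg_tk_left (nbhs_left_ge dlT)).
  by apply: filterS => k; exact: (hs k).1.
- by move=> k; exact: (hs k).2.
Qed.

Lemma endpoint_normal : is_normal P endpoint.
Proof.
split=> [i Y mY|u].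
  by have := measurable_endpoint i measurableT mY; rewrite setTI.
have [|s s0 hs] := @law_endpoint u 0 0 (lexx _) T0.
  by move=> t n _; exact: sqrtr_ge0.
by exists 0, s; split => // Y mY; rewrite hs// gauss_law_normal_law.
Qed.

(* A coordinate of the endpoint has positive variance: an entry of [f Sigma]
   stays away from [0] on some [[0, dl]], and this window alone bounds from
   below the variances of the approximating Riemann sums. *)
Lemma ae_endpoint_neq0 : Sigma != 0 -> {ae P, forall w, endpoint w != 0}.
Proof.
move=> S0.
have F0 : f 0 *m Sigma != 0.
  apply: contraNneq S0 => h.
  (* [f 0] is invertible, so it cannot annihilate a nonzero [Sigma]. *)
  have e : mxexp A (ln (T - 0)) *m (f 0 *m Sigma) = Sigma.
    by rewrite mulmxA [f 0]mxpowRE mxexp_mulN mul1mx.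
  by rewrite -e h mulmx0.
have [i [k0 ik]] : exists i k, (f 0 *m Sigma) i k != 0.
  apply: contrapT => H; move/eqP: F0; apply; apply/matrixP => i k.
  by rewrite [RHS]mxE; apply/eqP; apply: contrapT => /negP h; apply: H; exists i, k.
pose u : 'cV[R]_d.+1 := delta_mx i ord0.
pose g0 s := (u^T *m f s *m Sigma) ord0 k0.
have g00 : g0 0 != 0.
  by rewrite /g0 -mulmxA trmx_delta -rowE mxE.
have cg0 : {for 0, continuous g0}.
  have fc a b : f s a b @[s --> 0] --> f 0 a b.
    have [dfab _] := mx_is_derive_mxpow A T0 a b.
    exact/differentiable_continuous/derivable1_diffP.
  have fc' : f s @[s --> 0] --> f 0 by apply/cvg_mxP.
  have h : u^T *m f s *m Sigma @[s --> 0] --> u^T *m f 0 *m Sigma.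
    by apply: cvg_mulmx; [exact: cvg_mulmxl|exact: cvg_cst].
  have h2 := cvg_mx_entry (f := fun s => u^T *m f s *m Sigma) (i := ord0) (j := k0) h.
  exact: h2.
pose ka := `|g0 0| / 2.
have ka0 : 0 < ka by rewrite divr_gt0// normr_gt0.
have /cvgrPdist_lt/(_ ka ka0)[e /= e0 he] := cg0.
pose dl := Num.min (e / 2) (T / 2).
have dl0 : 0 < dl by rewrite lt_min !divr_gt0.
have dle : dl < e by rewrite gt_min ltr_pdivrMr// ltr_pMr// ltr1n.
have dlT : dl < T by rewrite gt_min orbC ltr_pdivrMr// ltr_pMr// ltr1n.
have gka s : 0 <= s <= dl -> ka <= `|g0 s|.
  move=> /andP[s0 sdl].
  have h : `|g0 0 - g0 s| < ka.
    by apply: he; rewrite /= sub0r normrN ger0_norm// (le_lt_trans sdl).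
  have := ler_normD (g0 0 - g0 s) (g0 s); rewrite subrK; move: h.
  by rewrite /ka; lra.
pose c := Num.sqrt (ka ^+ 2 * dl).
have c0 : 0 < c by rewrite sqrtr_gt0 mulr_gt0// exprn_gt0.
have sdc t n : dl <= t < T -> c <= sd u t n.
  move=> /andP[dt tT]; have t0 : 0 < t := lt_le_trans dl0 dt.
  have gr0 j : 0 <= grid t n j by rewrite mulr_ge0 ?divr_ge0// ltW.
  have grS j : grid t n j.+1 - grid t n j = t / n.+1%:R.
    by rewrite /grid -mulrBr -mulrBl -natrB// subSnn mul1r.
  have tn0 : 0 < t / n.+1%:R by rewrite divr_gt0.
  (* Lengths of the cells truncated at [dl]: they telescope to [dl], never exceed the true cell
     length, and vanish for cells that begin after [dl]. *)
  have mn j : 0 <= Num.min (grid t n j.+1) dl - Num.min (grid t n j) dl <= t / n.+1%:R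
      /\ (dl < grid t n j -> Num.min (grid t n j.+1) dl - Num.min (grid t n j) dl = 0).
    have := grS j; have := tn0.
    move: (grid t n j.+1) (grid t n j) (t / _) => b a h h0 ab.
    by case: (leP b dl) => hb; case: (leP a dl) => ha;
      (split; [apply/andP; split; lra|move=> ?; lra]).
  rewrite /sd /c ler_sqrt; last first.
    apply: sumr_ge0 => j _; apply: sumr_ge0 => l _.
    by rewrite mulr_ge0 ?sqr_ge0// ltW.
  apply: (@le_trans _ _ (\sum_(j < n.+1) ka ^+ 2 *
      (Num.min (grid t n j.+1) dl - Num.min (grid t n j) dl))).
    rewrite -mulr_sumr -(big_mkord xpredT (fun j =>
      Num.min (grid t n j.+1) dl - Num.min (grid t n j) dl)).
    rewrite telescope_sumr//.
    have -> : grid t n n.+1 = t by rewrite /grid divff ?pnatr_eq0// mulr1.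
    have -> : grid t n 0 = 0 by rewrite /grid mul0r mulr0.
    by rewrite (min_r dt) (min_l (ltW dl0)) subr0.
  apply: ler_sum => j _; have [/andP[m0 m1] m2] := mn j.
  rewrite (bigD1 k0)//= -[leLHS]addr0 lerD//; last first.
    by apply: sumr_ge0 => l _; rewrite mulr_ge0 ?sqr_ge0// ltW.
  have [gd|gd] := boolP (grid t n j <= dl).
    have h2 : ka ^+ 2 <= g0 (grid t n j) ^+ 2.
      rewrite -(real_normK (num_real (g0 _))) lerXn2r ?nnegrE ?(ltW ka0)//.
      by apply: gka; rewrite gr0.
    exact: (ler_pM (sqr_ge0 _) m0 h2 m1).
  by rewrite m2 ?ltNge// mulr0 mulr_ge0 ?sqr_ge0// ltW.
have [s cs hs] := @law_endpoint u c dl (ltW c0) dlT sdc.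
have s0 : 0 < s := lt_le_trans c0 cs.
pose N := (fun w => (u^T *m endpoint w) ord0 ord0) @^-1` [set 0 : R].
exists N; split.
- have mZ : measurable_fun setT (fun w => (u^T *m endpoint w) ord0 ord0).
    by apply: measurable_functional => l; exact: measurable_endpoint.
  by rewrite -[X in measurable X]setTI; apply: mZ.
- rewrite /N hs// gauss_law_normal//.
  have /null_content_dominatesP h := @normal_prob_dominates R 0 s.
  apply: h; [exact: measurable_set1|exact: lebesgue_measure_set1].
- move=> w /=; move/negP; rewrite negbK => /eqP e1.
  by rewrite /N /= e1 mulmx0 mxE.
Qed.

End Solution.

Theorem proposition4p1 (R : realType) (dsp : measure_display)
    (Omega : measurableType dsp) (P : probability Omega R)
    (d m : nat) (hd : (0 < d)%N) (hm : (0 < m)%N)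
    (T : R) (hT : 0 < T) (A : 'M[R]_d) (Sigma : 'M[R]_(d, m))
    (B : R -> Omega -> 'cV[R]_m) (hB : is_wiener P T B)
    (hF : is_filtration T (completed_filtration P B))
    (X : R -> Omega -> 'cV[R]_d)
    (hX : is_strong_solution P T A Sigma B X)
    (hA : ReSpec A `<=` `]0, 1 / 2[) :
  (exists M : Omega -> 'cV[R]_d, is_normal P M /\
     {ae P, forall w, mxpowR (T - t) (- A) *m X t w @[t --> T^'-] --> M w}) /\
  (forall A' : 'M[R]_d, A *m A' = A' *m A ->
     (ReSpec (A - A') `<=` `]0, +oo[ ->
        {ae P, forall w,
           mxpowR (T - t) (- A') *m X t w @[t --> T^'-] --> (0 : 'cV[R]_d)}) /\
     (Sigma != 0 -> ReSpec (A - A') `<=` `]-oo, 0[ ->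
        {ae P, forall w,
           enorm (mxpowR (T - t) (- A') *m X t w) @[t --> T^'-] --> +oo})).
Proof.
case: d hd A Sigma X hX hA => // d _ A Sigma X hX hA.
case: m hm Sigma B hB hF hX => // m _ Sigma B hB hF hX.
split; first by exists (endpoint T A X); split;
  [exact: endpoint_normal hT hB hF hX hA|exact: ae_cvg_endpoint hT hB hX hA].
move=> A' AA'.
have cAA' : (A - A') *m (- A) = - A *m (A - A').
  by rewrite mulmxN mulNmx mulmxBl mulmxBr AA'.
have powD r : mxpowR r (- A') = mxpowR r (A - A') *m mxpowR r (- A).
  rewrite !mxpowRE -(mxexpD _ cAA') (_ : A - A' + - A = - A')//.
  by rewrite addrAC subrr add0r.
split=> [AA'0|S0 AA'0].
- apply: filterS (ae_cvg_endpoint hT hB hX hA) => w hw.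
  have h := cvg_mulmx (@cvg_mxpow_0 _ _ _ T AA'0) hw; rewrite mul0mx in h.
  have e : (fun t => mxpowR (T - t) (- A') *m X t w) =
      (fun t => mxpowR (T - t) (A - A') *m (mxpowR (T - t) (- A) *m X t w)).
    by apply/funext => t; rewrite powD mulmxA.
  rewrite e; exact: h.
(* Divergence reads the factorisation backwards: r^(-(A-A')) tends to 0, yet its product with
   r^(-A') X tends to the nonzero endpoint. *)
have AA'N : ReSpec (- (A - A')) `<=` `]0, +oo[.
  move=> x /ReSpecN /AA'0 /=; rewrite !in_itv/= andbT.
  by rewrite oppr_lt0.
apply: filterS2 (ae_cvg_endpoint hT hB hX hA)
  (ae_endpoint_neq0 hT hB hF hX hA S0) => w hw w0.
have e : (fun t => mxpowR (T - t) (- (A - A')) *m (mxpowR (T - t) (- A') *m X t w)) =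
    (fun t => mxpowR (T - t) (- A) *m X t w).
  apply/funext => t.
  by rewrite mulmxA powD !mxpowRE [mxexp _ _ *m (_ *m _)]mulmxA mxexpN_mul mul1mx.
have hw' : mxpowR (T - t) (- (A - A')) *m (mxpowR (T - t) (- A') *m X t w)
    @[t --> T^'-] --> endpoint T A X w by rewrite e.
exact: cvg_enorm_pinfty (@cvg_mxpow_0 _ _ _ T AA'N) hw' w0.
Qed.
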